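(* Let $K$ be a domain enclosed by a $\mathcal{C}_+^2$ closed and strictly convex plane curve $\gamma$, with area $A(K)$ and perimeter $L(K)$, let $\rho(\theta)$ be the radius of curvature of $\gamma$, let $\tilde A(K)$ denote the oriented area of the domain enclosed by the locus of curvature centers of $\gamma$, and let $S(K)$ denote the Steiner disc associated with $K$. Then for arbitrary real constants $\alpha,\beta,\lambda,\delta$ which satisfy $$2\alpha+\delta\ge 0,\qquad 2\alpha+4\pi\beta+\lambda\ge 0,\qquad 6\alpha-\lambda+4\delta>0,$$ we have $$h_1(K,S(K))^2\le C(\alpha,\lambda,\delta)\left(\alpha\int_0^{2\pi}\rho(\theta)^2\,d\theta+\beta L(K)^2+\lambda A(K)+\delta|\tilde A(K)|\right),$$ where $$C(\alpha,\lambda,\delta)=\max\left\{1,\ \frac{2}{\pi}\sum_{n=2}^\infty\frac{1}{\big(2\alpha(n^2-1)-\lambda+\delta n^2\big)(n^2-1)}\right\}.$$ Equality holds in this inequality if $\gamma$ is a circle and the parameters satisfy $2\alpha+4\pi\beta+\lambda=0$.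
   Context: A $\mathcal{C}_+^2$ closed and strictly convex plane curve is a closed convex curve of class $C^2$ with everywhere positive curvature. It is parametrized by the angle $\theta\in[0,2\pi]$ between the $x$-axis and the outward unit normal vector at the corresponding point. The Minkowski support function $p=p_K$ of $K$ (equivalently, of $\gamma$) is the $2\pi$-periodic function such that $$\gamma(\theta)=\big(p(\theta)\cos\theta-p'(\theta)\sin\theta,\ p(\theta)\sin\theta+p'(\theta)\cos\theta\big).$$ The radius of curvature is $\rho(\theta)=p(\theta)+p''(\theta)>0$. The perimeter is $L(K)=\int_0^{2\pi}p(\theta)\,d\theta$ and the area is $A(K)=\frac12\int_0^{2\pi}\big(p(\theta)^2-p'(\theta)^2\big)\,d\theta$. The locus of curvature centers is the curve $$\theta\mapsto\big(-p'(\theta)\sin\theta-p''(\theta)\cos\theta,\ p'(\theta)\cos\theta-p''(\theta)\sin\theta\big),$$ and the oriented area of the domain it encloses is $\tilde A(K)=\frac12\int_0^{2\pi}\big(p'(\theta)^2-p''(\theta)^2\big)\,d\theta$. For planar convex bodies $K,M$ with support functions $p_K,p_M$, the Hausdorff distance is $h_1(K,M)=\max_u|p_K(u)-p_M(u)|$, the maximum being over unit directions $u$ (equivalently over the angle $\theta\in[0,2\pi]$). The Steiner disc $S(K)$ of a planar convex body $K$ is the circular disc with radius $\frac{L(K)}{2\pi}$ and center at the Steiner point $$\overrightarrow{s}(K)=\frac1\pi\int_0^{2\pi}\overrightarrow{u}(\theta)\,p_K(\theta)\,d\theta,$$ where $\overrightarrow{u}(\theta)=(\cos\theta,\sin\theta)$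 is the outward unit normal vector with angle $\theta$. *)

(* Defs.v *)
From Stdlib Require Import Reals.
From Coquelicot Require Import Coquelicot.

Open Scope R_scope.

Definition point : Type := (R * R)%type.

Definition dot (x y : point) : R := fst x * fst y + snd x * snd y.

Definition eucl_dist (x y : point) : R :=
  sqrt ((fst x - fst y) ^ 2 + (snd x - snd y) ^ 2).

Definition unit_normal (theta : R) : point := (cos theta, sin theta).

Definition convex_set (K : point -> Prop) : Prop :=
  forall x y s, K x -> K y -> 0 <= s <= 1 ->
    K ((1 - s) * fst x + s * fst y, (1 - s) * snd x + s * snd y).

Definition bounded_set (K : point -> Prop) : Prop :=
  exists M, forall x, K x -> eucl_dist x (0, 0) <= M.

Definition boundary (K : point -> Prop) (x : point) : Prop :=
  ~ locally x K /\ ~ locally x (fun y => ~ K y).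

Definition convex_body (K : point -> Prop) : Prop :=
  convex_set K /\ closed K /\ bounded_set K /\ exists x : point, locally x K.

Definition class_C2 (f : R -> R) : Prop :=
  (forall t, ex_derive f t) /\
  (forall t, ex_derive (Derive f) t) /\
  (forall t, continuous (Derive (Derive f)) t).

Definition xcoord (gamma : R -> point) (t : R) : R := fst (gamma t).
Definition ycoord (gamma : R -> point) (t : R) : R := snd (gamma t).

Definition speed (gamma : R -> point) (t : R) : R :=
  sqrt (Derive (xcoord gamma) t ^ 2 + Derive (ycoord gamma) t ^ 2).

(* Unsigned curvature, so that neither orientation of the curve is excluded. *)
Definition curvature (gamma : R -> point) (t : R) : R :=
  Rabs (Derive (xcoord gamma) t * Derive (Derive (ycoord gamma)) t
        - Derive (ycoord gamma) t * Derive (Derive (xcoord gamma)) t)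
  / speed gamma t ^ 3.

Definition simple_closed (gamma : R -> point) : Prop :=
  exists T, 0 < T /\ (forall t, gamma (t + T) = gamma t) /\
    (forall s t, 0 <= s < T -> 0 <= t < T -> gamma s = gamma t -> s = t).

(* The curve gamma, in an arbitrary regular parametrization, bounds K. *)
Definition encloses (gamma : R -> point) (K : point -> Prop) : Prop :=
  convex_body K /\ forall x, boundary K x <-> exists t, gamma t = x.

Definition closed_convex_curve (gamma : R -> point) : Prop :=
  simple_closed gamma /\ exists K, encloses gamma K.

Definition C2_plus_curve (gamma : R -> point) : Prop :=
  closed_convex_curve gamma /\
  class_C2 (xcoord gamma) /\ class_C2 (ycoord gamma) /\
  (forall t, 0 < speed gamma t) /\
  (forall t, 0 < curvature gamma t).

Definition is_circle (gamma : R -> point) : Prop :=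
  exists (c : point) (r : R), 0 < r /\
    forall x, (exists t, gamma t = x) <-> eucl_dist x c = r.

Definition support (K : point -> Prop) (theta : R) : R :=
  real (Lub_Rbar (fun r => exists x, K x /\ r = dot x (unit_normal theta))).

(* The quantities below are expressed through the support function p of K and
   the angle theta of the outward normal; for a C^2_+ boundary p is of class
   C^2 and p + p'' is the radius of curvature at the point with that normal. *)
Definition curvature_radius (K : point -> Prop) (theta : R) : R :=
  support K theta + Derive (Derive (support K)) theta.

Definition perimeter (K : point -> Prop) : R := RInt (support K) 0 (2 * PI).

Definition area (K : point -> Prop) : R :=
  / 2 * RInt (fun theta => support K theta ^ 2 - Derive (support K) theta ^ 2)
          0 (2 * PI).

(* Oriented area enclosed by the locus of curvature centers
   (- p' sin - p'' cos, p' cos - p'' sin). *)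
Definition evolute_area (K : point -> Prop) : R :=
  / 2 * RInt (fun theta => Derive (support K) theta ^ 2
                           - Derive (Derive (support K)) theta ^ 2)
          0 (2 * PI).

Definition hausdorff_dist (K M : point -> Prop) : R :=
  real (Lub_Rbar (fun d => exists theta, 0 <= theta <= 2 * PI /\
                           d = Rabs (support K theta - support M theta))).

Definition steiner_point (K : point -> Prop) : point :=
  (/ PI * RInt (fun theta => cos theta * support K theta) 0 (2 * PI),
   / PI * RInt (fun theta => sin theta * support K theta) 0 (2 * PI)).

Definition steiner_disc (K : point -> Prop) (x : point) : Prop :=
  eucl_dist x (steiner_point K) <= perimeter K / (2 * PI).

Definition steiner_const (alpha lambda delta : R) : R :=
  Rmax 1
    (2 / PI * Series (fun k => let n := INR (k + 2) in
       / ((2 * alpha * (n ^ 2 - 1) - lambda + delta * n ^ 2) * (n ^ 2 - 1)))).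

(* Main.v *)
(* Put p for the support function of K, c_n^2 = a_n^2 + b_n^2 for its Fourier
   coefficients and d_n = 2 alpha (n^2 - 1) - lambda + delta n^2, which is positive
   for n >= 2. The functional on the right-hand side is at least
     pi a_0^2 (2 alpha + 4 pi beta + lambda) + pi/2 sum_{n>=2} (n^2 - 1) d_n c_n^2:
   Parseval's identity for the integrals of p^2 and p'^2 = - p p'' needs only the
   uniform convergence of the Fourier series of p, and since p''^2 enters with the
   coefficient alpha + delta/2 >= 0, Bessel's inequality suffices for it.
   The support function of the Steiner disc is the part of order at most 1 of the
   Fourier series of p, so the difference at theta is bounded by the sum of the
   remaining c_n, and Cauchy-Schwarz with the weights (n^2 - 1) d_n concludes.
   For a circle the functional is pi r^2 (2 alpha + 4 pi beta + lambda).

   That p is of class C^2 comes from the geometry: each tangent line of gamma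
   supports K, and the normal angle is a C^1 function of the parameter with
   nowhere vanishing derivative, hence has a C^1 inverse. *)

Require Import Defs.
From Stdlib Require Import Reals ZArith Lra Lia Psatz.
From Coquelicot Require Import Coquelicot.
Open Scope R_scope.

(** * Integrals of trigonometric sums and the Bessel inequality *)

(** The order-n harmonic enters the functional with a polynomial in n^2 that has the factor n^2 - 1.
    It vanishes at n = 1, which expresses translation invariance, so the harmonics left over are
    exactly those that survive in the distance to the Steiner disc. The oriented area of the evolute
    is never positive, because the integral of p'^2 is at most that of p''^2. Its absolute value is
    therefore a quadratic form in p, whatever the sign of delta. Each parameter condition supplies
    one sign: that of the coefficient of the integral of p''^2, that of the coefficient of a_0^2,
    and that of d_2 = 6 alpha - lambda + 4 delta. The identity d_n = (2 alpha + delta) (n^2 - 4) +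
    d_2 then makes every later d_n positive. Bessel's inequality is the only source of convergence:
    it gives the Riemann-Lebesgue lemma, hence pointwise convergence through the Dirichlet kernel,
    and, applied to p'', the rate that makes this convergence uniform. *)

Lemma continuous_Rplus (f g : R -> R) x :
  continuous f x -> continuous g x -> continuous (fun t => f t + g t) x.
Proof. exact (continuous_plus f g x). Qed.

Lemma continuous_Rminus (f g : R -> R) x :
  continuous f x -> continuous g x -> continuous (fun t => f t - g t) x.
Proof. exact (continuous_minus f g x). Qed.

Lemma continuous_Ropp (f : R -> R) x :
  continuous f x -> continuous (fun t => - f t) x.
Proof. exact (continuous_opp f x). Qed.

Lemma continuous_Rmult (f g : R -> R) x :
  continuous f x -> continuous g x -> continuous (fun t => f t * g t) x.
Proof. exact (continuous_mult f g x). Qed.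

Lemma continuous_pow (f : R -> R) n x :
  continuous f x -> continuous (fun t => f t ^ n) x.
Proof.
  intros Hf; induction n as [|n IH]; simpl.
  - apply continuous_const.
  - now apply continuous_Rmult.
Qed.

Lemma continuous_Rcos (f : R -> R) x :
  continuous f x -> continuous (fun t => cos (f t)) x.
Proof. intros Hf; apply (continuous_comp f cos); [exact Hf|apply continuous_cos]. Qed.

Lemma continuous_Rsin (f : R -> R) x :
  continuous f x -> continuous (fun t => sin (f t)) x.
Proof. intros Hf; apply (continuous_comp f sin); [exact Hf|apply continuous_sin]. Qed.

Lemma continuous_sum_f_R0 (F : nat -> R -> R) N x :
  (forall k, continuous (F k) x) -> continuous (fun t => sum_f_R0 (fun k => F k t) N) x.
Proof.
  intros HF; induction N as [|N IH]; simpl; [apply HF|].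
  apply continuous_Rplus; [exact IH|apply HF].
Qed.

Lemma is_derive_continuous (f : R -> R) (x l : R) : is_derive f x l -> continuous f x.
Proof. intros H; apply @ex_derive_continuous; now exists l. Qed.

Lemma is_derive_eq (f : R -> R) (x l m : R) : is_derive f x l -> l = m -> is_derive f x m.
Proof. now intros H <-. Qed.

Lemma is_derive_Rplus (f g : R -> R) (x l m : R) : is_derive f x l -> is_derive g x m ->
  is_derive (fun t => f t + g t) x (l + m).
Proof. exact (is_derive_plus f g x l m). Qed.

Lemma is_derive_Rminus (f g : R -> R) (x l m : R) : is_derive f x l -> is_derive g x m ->
  is_derive (fun t => f t - g t) x (l - m).
Proof. exact (is_derive_minus f g x l m). Qed.

Lemma is_derive_Rmult (f g : R -> R) (x l m : R) : is_derive f x l -> is_derive g x m ->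
  is_derive (fun t => f t * g t) x (l * g x + f x * m).
Proof. intros Hf Hg; exact (is_derive_mult f g x l m Hf Hg Rmult_comm). Qed.

Lemma is_derive_Rcomp (f g : R -> R) (x l m : R) : is_derive f (g x) l -> is_derive g x m ->
  is_derive (fun t => f (g t)) x (m * l).
Proof. exact (is_derive_comp f g x l m). Qed.

Lemma is_derive_Rdiv (f g : R -> R) (x l m : R) : is_derive f x l -> is_derive g x m -> g x <> 0 ->
  is_derive (fun t => f t / g t) x ((l * g x - m * f x) / g x ^ 2).
Proof.
  intros Hf Hg Hne.
  apply (is_derive_eq _ _ _ _ (is_derive_div f g x l m Hf Hg Hne)); field; exact Hne.
Qed.

(** Atoms are settled from the context: a derivative known everywhere gives continuity, and a
    continuity hypothesis restricted to an interval is applied once its side condition is found. *)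
Ltac cont_leaf :=
  first
    [ assumption
    | match goal with
      | H : forall t, is_derive ?f t _ |- continuous ?f ?x =>
          exact (is_derive_continuous f x _ (H x))
      | H : forall t, is_derive ?f t _ |- continuous (fun s => ?f s) ?x =>
          exact (is_derive_continuous f x _ (H x))
      | H : forall t, continuous ?f t |- continuous _ ?x => exact (H x)
      | H : forall t, _ -> continuous ?f t |- continuous _ ?x =>
          apply (H x); first [assumption | lra]
      | H : forall k t, continuous _ t |- continuous _ ?x => exact (H _ x)
      | H : forall k t, _ -> continuous _ t |- continuous _ ?x =>
          apply (H _ x); first [assumption | lra]
      end ].

(** The recursion matches on syntax, which is why the rules above are stated with the operations of
    R instead of those of an abstract module. *)
Ltac cont :=
  lazymatch goal with
  | |- continuous (fun _ => ?c) _ => apply continuous_const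
  | |- continuous (fun t => t) _ => apply continuous_id
  | |- continuous (fun t => @?f t + @?g t) ?x => apply (continuous_Rplus f g x); cont
  | |- continuous (fun t => @?f t - @?g t) ?x => apply (continuous_Rminus f g x); cont
  | |- continuous (fun t => @?f t * @?g t) ?x => apply (continuous_Rmult f g x); cont
  | |- continuous (fun t => - @?f t) ?x => apply (continuous_Ropp f x); cont
  | |- continuous (fun t => @?f t ^ ?n) ?x => apply (continuous_pow f n x); cont
  | |- continuous (fun t => cos (@?f t)) ?x => apply (continuous_Rcos f x); cont
  | |- continuous (fun t => sin (@?f t)) ?x => apply (continuous_Rsin f x); cont
  | |- continuous (fun t => sum_f_R0 (fun k => @?F t k) ?N) ?x =>
      apply (continuous_sum_f_R0 (fun k t => F t k) N x); intro; cont
  | |- _ => cont_leaf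
  end.

Lemma ex_RInt_on (f : R -> R) a b :
  a <= b -> (forall x, a <= x <= b -> continuous f x) -> ex_RInt f a b.
Proof.
  intros Hab Hf; apply @ex_RInt_continuous; intros z Hz; apply Hf.
  now rewrite Rmin_left, Rmax_right in Hz by assumption.
Qed.

Lemma ex_RInt_everywhere (f : R -> R) a b :
  (forall x, continuous f x) -> ex_RInt f a b.
Proof. intros Hf; apply @ex_RInt_continuous; intros z _; apply Hf. Qed.

Lemma RInt_Rplus (f g : R -> R) a b : ex_RInt f a b -> ex_RInt g a b ->
  RInt (fun t => f t + g t) a b = RInt f a b + RInt g a b :> R.
Proof. exact (RInt_plus f g a b). Qed.

Lemma RInt_Rminus (f g : R -> R) a b : ex_RInt f a b -> ex_RInt g a b ->
  RInt (fun t => f t - g t) a b = RInt f a b - RInt g a b :> R.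
Proof. exact (RInt_minus f g a b). Qed.

Lemma RInt_Rscal (f : R -> R) c a b : ex_RInt f a b ->
  RInt (fun t => c * f t) a b = c * RInt f a b :> R.
Proof. exact (RInt_scal f a b c). Qed.

Lemma RInt_eq (f g : R -> R) a b : (forall t, f t = g t) -> RInt f a b = RInt g a b :> R.
Proof. intros H; apply RInt_ext; intros; apply H. Qed.

Lemma RInt_sum_f_R0 (F : nat -> R -> R) N a b : a <= b ->
  (forall k x, a <= x <= b -> continuous (F k) x) ->
  RInt (fun t => sum_f_R0 (fun k => F k t) N) a b
  = sum_f_R0 (fun k => RInt (F k) a b) N :> R.
Proof.
  intros Hab HF; induction N as [|N IH]; simpl; [reflexivity|].
  rewrite RInt_Rplus, IH; [reflexivity| |]; apply ex_RInt_on; trivial; intros x Hx; cont.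
Qed.

(** Pythagoras for an orthogonal family. The induction on [N] meets only products with [F (S N)] as
    second factor, so orthogonality for [j < k] is enough. *)
Lemma RInt_sum_sqr (F : nat -> R -> R) N a b : a <= b ->
  (forall k x, a <= x <= b -> continuous (F k) x) ->
  (forall j k, (j < k)%nat -> RInt (fun t => F j t * F k t) a b = 0 :> R) ->
  RInt (fun t => sum_f_R0 (fun k => F k t) N ^ 2) a b
  = sum_f_R0 (fun k => RInt (fun t => F k t ^ 2) a b) N :> R.
Proof.
  intros Hab HF Horth.
  induction N as [|N IH]; [reflexivity|].
  rewrite tech5, <- IH.
  rewrite (RInt_eq _ (fun t => (sum_f_R0 (fun k => F k t) N ^ 2
     + 2 * sum_f_R0 (fun k => F k t * F (S N) t) N) + F (S N) t ^ 2)).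
  2:{ intros t; rewrite tech5, <- (scal_sum _ _ (F (S N) t)); ring. }
  assert (H0 : RInt (fun t => sum_f_R0 (fun k => F k t * F (S N) t) N) a b = 0 :> R).
  { rewrite RInt_sum_f_R0; [|exact Hab|].
    - rewrite (sum_eq _ (fun _ => 0)).
      + rewrite sum_cte; ring.
      + intros i Hi; apply Horth; lia.
    - intros k x Hx; cont. }
  rewrite RInt_Rplus, RInt_Rplus, RInt_Rscal, H0; [ring| | | | |];
    apply ex_RInt_on; trivial; intros x Hx; cont.
Qed.

(** The frequency is real and the periodicity a hypothesis because the product formulas produce the
    differences [INR m - INR n], which may be negative. *)
Lemma RInt_wave (w A B a : R) : w <> 0 ->
  cos (w * (a + 2 * PI)) = cos (w * a) -> sin (w * (a + 2 * PI)) = sin (w * a) ->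
  RInt (fun t => A * cos (w * t) + B * sin (w * t)) a (a + 2 * PI) = 0 :> R.
Proof.
  intros Hw Hc Hs.
  apply is_RInt_unique.
  replace 0 with (minus ((A * sin (w * (a + 2 * PI)) - B * cos (w * (a + 2 * PI))) / w)
                        ((A * sin (w * a) - B * cos (w * a)) / w))
    by (rewrite Hc, Hs; unfold minus, plus, opp; simpl; ring).
  apply (is_RInt_derive (fun t => (A * sin (w * t) - B * cos (w * t)) / w)).
  - intros x _; auto_derive; [trivial|]; now field.
  - intros x _; cont.
Qed.

Lemma RInt_wave_product (A B C D : R) (m n : nat) (a : R) : m <> n -> (m + n)%nat <> 0%nat ->
  RInt (fun t => (A * cos (INR m * t) + B * sin (INR m * t))
               * (C * cos (INR n * t) + D * sin (INR n * t))) a (a + 2 * PI) = 0 :> R.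
Proof.
  intros Hmn Hpos.
  assert (Hper : forall k, cos (INR k * (a + 2 * PI)) = cos (INR k * a)
                        /\ sin (INR k * (a + 2 * PI)) = sin (INR k * a)).
  { intros k; replace (INR k * (a + 2 * PI)) with (INR k * a + 2 * INR k * PI) by ring.
    split; [apply cos_period|apply sin_period]. }
  destruct (Hper m) as [Hcm Hsm], (Hper n) as [Hcn Hsn].
  rewrite (RInt_eq _ (fun t =>
     ((A * C + B * D) / 2 * cos ((INR m - INR n) * t)
      + (B * C - A * D) / 2 * sin ((INR m - INR n) * t))
     + ((A * C - B * D) / 2 * cos ((INR m + INR n) * t)
      + (A * D + B * C) / 2 * sin ((INR m + INR n) * t)))).
  2:{ intros t; rewrite (Rmult_minus_distr_r (INR m) (INR n) t), (Rmult_plus_distr_r (INR m) (INR n) t).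
      rewrite cos_plus, cos_minus, sin_plus, sin_minus; field. }
  rewrite RInt_Rplus by (apply ex_RInt_everywhere; intros x; cont).
  rewrite !RInt_wave; [ring| | | | | |].
  - rewrite <- plus_INR; now apply not_0_INR.
  - rewrite !Rmult_plus_distr_r, !cos_plus; congruence.
  - rewrite !Rmult_plus_distr_r, !sin_plus; congruence.
  - intros H; apply Hmn, INR_eq; lra.
  - rewrite !Rmult_minus_distr_r, !cos_minus; congruence.
  - rewrite !Rmult_minus_distr_r, !sin_minus; congruence.
Qed.

Lemma RInt_wave_sqr (A B : R) (n : nat) (a : R) : n <> 0%nat ->
  RInt (fun t => (A * cos (INR n * t) + B * sin (INR n * t)) ^ 2) a (a + 2 * PI)
  = PI * (A ^ 2 + B ^ 2) :> R.
Proof.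
  intros Hn.
  assert (Hper : forall k, cos (INR k * (a + 2 * PI)) = cos (INR k * a)
                        /\ sin (INR k * (a + 2 * PI)) = sin (INR k * a)).
  { intros k; replace (INR k * (a + 2 * PI)) with (INR k * a + 2 * INR k * PI) by ring.
    split; [apply cos_period|apply sin_period]. }
  destruct (Hper (2 * n)%nat) as [Hc Hs].
  rewrite mult_INR in Hc, Hs; change (INR 2) with 2 in Hc, Hs.
  rewrite (RInt_eq _ (fun t => (A ^ 2 + B ^ 2) / 2
     + ((A ^ 2 - B ^ 2) / 2 * cos (2 * INR n * t) + A * B * sin (2 * INR n * t)))).
  2:{ intros t; rewrite Rmult_assoc, cos_2a, sin_2a.
      generalize (sin2_cos2 (INR n * t)); unfold Rsqr; intros H.
      replace ((A ^ 2 + B ^ 2) / 2) with ((A ^ 2 + B ^ 2) / 2 * 1) by ring.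
      rewrite <- H; field. }
  rewrite RInt_Rplus by (apply ex_RInt_everywhere; intros x; cont).
  rewrite RInt_wave, RInt_const; trivial.
  - unfold scal; simpl; unfold mult; simpl; field.
  - apply not_0_INR in Hn; lra.
Qed.

(** Continuity is asked on one period only: the lemma is later applied to a quotient by sin(t/2),
    which is continuous on [-PI, PI] but not on the whole line. *)
Lemma bessel (f : R -> R) (a : R) (N : nat) :
  (forall x, a <= x <= a + 2 * PI -> continuous f x) ->
  sum_f_R0 (fun k =>
      RInt (fun t => f t * cos (INR (S k) * t)) a (a + 2 * PI) ^ 2
    + RInt (fun t => f t * sin (INR (S k) * t)) a (a + 2 * PI) ^ 2) N
  <= PI * RInt (fun t => f t ^ 2) a (a + 2 * PI).
Proof.
  intros Hf.
  assert (HPI := PI_RGT_0).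
  assert (Hab : a <= a + 2 * PI) by lra.
  set (A := fun k => RInt (fun t => f t * cos (INR (S k) * t)) a (a + 2 * PI)).
  set (B := fun k => RInt (fun t => f t * sin (INR (S k) * t)) a (a + 2 * PI)).
  set (F := fun k t => A k * cos (INR (S k) * t) + B k * sin (INR (S k) * t)).
  change (sum_f_R0 (fun k => A k ^ 2 + B k ^ 2) N <= PI * RInt (fun t => f t ^ 2) a (a + 2 * PI)).
  set (Sg := sum_f_R0 (fun k => A k ^ 2 + B k ^ 2) N).
  assert (HF : forall k x, continuous (F k) x) by (intros k x; unfold F; cont).
  assert (Hgg : RInt (fun t => sum_f_R0 (fun k => F k t) N ^ 2) a (a + 2 * PI) = PI * Sg :> R).
  { rewrite RInt_sum_sqr; trivial.
    - unfold Sg; rewrite scal_sum; apply sum_eq; intros k _.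
      unfold F; rewrite RInt_wave_sqr by discriminate; ring.
    - intros j k Hjk; unfold F; apply RInt_wave_product; lia. }
  assert (Hfg : RInt (fun t => sum_f_R0 (fun k => f t * F k t) N) a (a + 2 * PI) = Sg :> R).
  { rewrite (RInt_sum_f_R0 (fun k t => f t * F k t)); trivial.
    - apply sum_eq; intros k _.
      rewrite (RInt_eq _ (fun t => A k * (f t * cos (INR (S k) * t))
                                 + B k * (f t * sin (INR (S k) * t))))
        by (intros t; unfold F; ring).
      rewrite RInt_Rplus, !RInt_Rscal;
        [fold (A k); fold (B k); ring| | | |];
        apply ex_RInt_on; trivial; intros x Hx; cont.
    - intros k x Hx; cont. }
  (* With unnormalized coefficients the projection of [PI * f] is the sum of the [F k]. Expanding
     gives PI^2 times the integral of f^2, minus 2 PI [Sg], plus PI [Sg]; dividing by PI is the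
     claim. *)
  assert (H : 0 <= RInt (fun t => (PI * f t - sum_f_R0 (fun k => F k t) N) ^ 2) a (a + 2 * PI)).
  { apply RInt_ge_0; trivial.
    - apply ex_RInt_on; trivial; intros x Hx; cont.
    - intros x _; apply pow2_ge_0. }
  rewrite (RInt_eq _ (fun t => (PI ^ 2 * f t ^ 2 + (- (2 * PI)) * sum_f_R0 (fun k => f t * F k t) N)
      + sum_f_R0 (fun k => F k t) N ^ 2)) in H.
  2:{ intros t. rewrite (sum_eq (fun k => f t * F k t) (fun k => F k t * f t)) by (intros; ring).
      rewrite <- scal_sum; ring. }
  rewrite RInt_Rplus, RInt_Rplus, !RInt_Rscal, Hfg, Hgg in H;
    try (apply ex_RInt_on; trivial; intros x Hx; cont).
  apply Rmult_le_reg_l with PI; nra.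
Qed.

(** * Positive series and the Riemann-Lebesgue lemma *)

Lemma ex_series_bounded (u : nat -> R) (M : R) :
  (forall n, 0 <= u n) -> (forall N, sum_f_R0 u N <= M) -> ex_series u.
Proof.
  intros Hpos HM.
  destruct (ex_finite_lim_seq_incr (sum_f_R0 u) M) as [l Hl]; trivial.
  - intros n; generalize (Hpos (S n)); simpl; lra.
  - exists l.
    apply (filterlim_ext (sum_f_R0 u)); [|exact Hl].
    intros n; symmetry; apply sum_n_Reals.
Qed.

Lemma sum_le_Series (u : nat -> R) (N : nat) :
  (forall n, 0 <= u n) -> ex_series u -> sum_f_R0 u N <= Series u.
Proof.
  intros Hpos Hex.
  rewrite <- sum_n_Reals.
  apply (is_lim_seq_incr_compare (sum_n u)).
  - exact (Series_correct u Hex).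
  - intros n; rewrite sum_Sn; generalize (Hpos (S n)); unfold plus; simpl; lra.
Qed.

(** By Bessel the squared coefficients are summable, so they tend to 0. *)
Lemma riemann_lebesgue (f : R -> R) (a : R) :
  (forall x, a <= x <= a + 2 * PI -> continuous f x) ->
  is_lim_seq (fun n => RInt (fun t => f t * cos (INR (S n) * t)) a (a + 2 * PI)) 0 /\
  is_lim_seq (fun n => RInt (fun t => f t * sin (INR (S n) * t)) a (a + 2 * PI)) 0.
Proof.
  intros Hf.
  set (A := fun k => RInt (fun t => f t * cos (INR (S k) * t)) a (a + 2 * PI)).
  set (B := fun k => RInt (fun t => f t * sin (INR (S k) * t)) a (a + 2 * PI)).
  assert (Hlim : is_lim_seq (fun k => A k ^ 2 + B k ^ 2) 0).
  { apply ex_series_lim_0.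
    apply (ex_series_bounded _ (PI * RInt (fun t => f t ^ 2) a (a + 2 * PI))).
    - intros n; generalize (pow2_ge_0 (A n)) (pow2_ge_0 (B n)); lra.
    - intros n; now apply bessel. }
  assert (Hsqrt : is_lim_seq (fun k => sqrt (A k ^ 2 + B k ^ 2)) 0).
  { rewrite <- sqrt_0.
    apply (is_lim_seq_continuous sqrt _ 0); [|exact Hlim].
    apply continuity_pt_filterlim, continuous_sqrt. }
  assert (Habs : forall u : nat -> R, (forall k, u k ^ 2 <= A k ^ 2 + B k ^ 2) -> is_lim_seq u 0).
  { intros u Hu; apply is_lim_seq_abs_0.
    apply (is_lim_seq_le_le (fun _ => 0) _ (fun k => sqrt (A k ^ 2 + B k ^ 2))); trivial.
    - intros k; split; [apply Rabs_pos|].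
      rewrite <- sqrt_Rsqr_abs; apply sqrt_le_1_alt; unfold Rsqr.
      generalize (Hu k); simpl; lra.
    - apply is_lim_seq_const. }
  split; apply Habs; intros k;
    generalize (pow2_ge_0 (A k)) (pow2_ge_0 (B k)); lra.
Qed.

(** * Pointwise convergence of Fourier series *)

(** Caratheodory's form of differentiability. Quotients and inverse functions are then handled by
    continuity of the slope function, without difference quotients. *)
Lemma is_derive_slope (f : R -> R) x0 l : is_derive f x0 l ->
  exists phi : R -> R, continuous phi x0 /\ phi x0 = l /\
    forall t, f t - f x0 = phi t * (t - x0).
Proof.
  intros Hf.
  exists (fun t => if Req_EM_T t x0 then l else (f t - f x0) / (t - x0)).
  split; [|split].
  - apply is_derive_Reals in Hf.
    apply continuity_pt_filterlim; intros eps Heps.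
    destruct (Hf eps Heps) as [d Hd].
    exists d; split; [apply cond_pos|].
    intros t [_ Ht]; simpl in *; unfold R_dist in *.
    destruct (Req_EM_T x0 x0) as [_|Hx]; [|contradiction].
    destruct (Req_EM_T t x0) as [_|Hne].
    + rewrite Rminus_diag, Rabs_R0; exact Heps.
    + specialize (Hd (t - x0)).
      replace (x0 + (t - x0)) with t in Hd by ring.
      apply Hd; [lra|exact Ht].
  - destruct (Req_EM_T x0 x0); [reflexivity|contradiction].
  - intros t; destruct (Req_EM_T t x0) as [->|Hne]; [ring|].
    field; lra.
Qed.

Lemma slope_is_derive (f phi : R -> R) x0 : continuous phi x0 ->
  (forall t, f t - f x0 = phi t * (t - x0)) -> is_derive f x0 (phi x0).
Proof.
  intros Hphi Hf.
  apply is_derive_Reals; intros eps Heps.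
  apply continuity_pt_filterlim in Hphi.
  destruct (Hphi eps Heps) as [d [Hd H]].
  exists (mkposreal d Hd); intros h Hh Hhd; simpl in Hhd.
  rewrite Hf; replace (phi (x0 + h) * (x0 + h - x0) / h) with (phi (x0 + h)) by (field; exact Hh).
  apply (H (x0 + h)); split.
  - split; [exact I|lra].
  - simpl; unfold R_dist; now replace (x0 + h - x0) with h by ring.
Qed.

Definition periodic (f : R -> R) : Prop := forall t, f (t + 2 * PI) = f t.

Lemma periodic_cos (n : nat) : periodic (fun t => cos (INR n * t)).
Proof.
  intros t; replace (INR n * (t + 2 * PI)) with (INR n * t + 2 * INR n * PI) by ring.
  apply cos_period.
Qed.

Lemma periodic_sin (n : nat) : periodic (fun t => sin (INR n * t)).
Proof.
  intros t; replace (INR n * (t + 2 * PI)) with (INR n * t + 2 * INR n * PI) by ring.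
  apply sin_period.
Qed.

(** The period is centred at 0 so that sin(t/2) vanishes in it only at t = 0. *)
Lemma RInt_periodic_shift (f : R -> R) (a : R) :
  (forall x, continuous f x) -> periodic f ->
  RInt (fun t => f (a + t)) (- PI) (- PI + 2 * PI) = RInt f 0 (2 * PI) :> R.
Proof.
  intros Hf Hper.
  assert (Hex : forall u v, ex_RInt f u v) by (intros; now apply ex_RInt_everywhere).
  assert (Hlin : forall u v b, RInt (fun t => f (b + t)) u v = RInt f (u + b) (v + b) :> R).
  { intros u v b.
    replace (u + b) with (1 * u + b) by ring; replace (v + b) with (1 * v + b) by ring.
    rewrite <- (RInt_comp_lin f 1 b u v) by apply Hex.
    apply RInt_ext; intros x _; unfold scal; simpl; unfold mult; simpl.
    rewrite !Rmult_1_l; now rewrite Rplus_comm. }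
  rewrite Hlin.
  set (b := - PI + a); replace (- PI + 2 * PI + a) with (b + 2 * PI) by (unfold b; ring).
  rewrite <- (RInt_Chasles f b 0 (b + 2 * PI)) by apply Hex.
  rewrite <- (RInt_Chasles f 0 (2 * PI) (b + 2 * PI)) by apply Hex.
  assert (H : RInt f (2 * PI) (b + 2 * PI) = RInt f 0 b :> R).
  { replace (2 * PI) with (0 + 2 * PI) at 1 by ring.
    rewrite <- Hlin; apply RInt_eq; intros t; rewrite Rplus_comm; apply Hper. }
  rewrite H, <- (opp_RInt_swap f 0 b) by apply Hex.
  unfold plus, opp; simpl; ring.
Qed.

Definition fcos (f : R -> R) (n : nat) : R := RInt (fun t => f t * cos (INR n * t)) 0 (2 * PI).
Definition fsin (f : R -> R) (n : nat) : R := RInt (fun t => f t * sin (INR n * t)) 0 (2 * PI).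
Definition harmonic (f : R -> R) (n : nat) (t : R) : R :=
  fcos f n * cos (INR n * t) + fsin f n * sin (INR n * t).
(* Coefficients are not divided by [PI], so these sums converge to [PI * f]. *)
Definition fourier_sum (f : R -> R) (N : nat) (t : R) : R :=
  fcos f 0 / 2 + sum_f_R0 (fun k => harmonic f (S k) t) N.

Lemma harmonic_shift (f : R -> R) (n : nat) (a : R) :
  (forall x, continuous f x) -> periodic f ->
  harmonic f n a
  = RInt (fun t => f (a + t) * cos (INR n * t)) (- PI) (- PI + 2 * PI).
Proof.
  intros Hf Hper.
  rewrite (RInt_eq _ (fun t => (fun s => f s * (cos (INR n * a) * cos (INR n * s)
       + sin (INR n * a) * sin (INR n * s))) (a + t))).
  - rewrite (RInt_periodic_shift (fun s => f s * (cos (INR n * a) * cos (INR n * s)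
       + sin (INR n * a) * sin (INR n * s)))).
    + rewrite (RInt_eq _ (fun s => cos (INR n * a) * (f s * cos (INR n * s))
       + sin (INR n * a) * (f s * sin (INR n * s)))) by (intros; ring).
      rewrite RInt_Rplus, !RInt_Rscal;
        [unfold harmonic, fcos, fsin; ring| | | |];
        apply ex_RInt_everywhere; intros x; cont.
    + intros x; cont.
    + intros t; rewrite Hper, (periodic_cos n t), (periodic_sin n t); reflexivity.
  - intros t; f_equal.
    rewrite <- cos_minus, <- cos_neg; f_equal; ring.
Qed.

(** The product 2 sin(t/2) cos(kt) is sin(kt + t/2) - sin(kt - t/2), so the sum telescopes. Its last
    frequency is [S N] because summation starts with [S 0]. *)
Lemma dirichlet_kernel (N : nat) (t : R) :
  2 * sin (t / 2) * (/ 2 + sum_f_R0 (fun k => cos (INR (S k) * t)) N)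
  = sin (INR (S N) * t + t / 2).
Proof.
  assert (H : forall x, 2 * sin (t / 2) * cos x = sin (x + t / 2) - sin (x - t / 2))
    by (intros x; rewrite sin_plus, sin_minus; ring).
  induction N as [|N IH]; cbn [sum_f_R0].
  - rewrite Rmult_plus_distr_l, H; simpl.
    replace (1 * t - t / 2) with (t / 2) by field; field.
  - rewrite <- Rplus_assoc, Rmult_plus_distr_l, IH, H.
    rewrite (S_INR (S N)).
    replace ((INR (S N) + 1) * t - t / 2) with (INR (S N) * t + t / 2) by field; ring.
Qed.

(** The error is the integral of f(a + t) - f(a) against the Dirichlet kernel. Splitting sin(nt +
    t/2) by the addition formula turns it into one sine and one cosine coefficient of two continuous
    functions, and Riemann-Lebesgue applies to both. *)
Lemma fourier_converges (f f' : R -> R) (a : R) :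
  (forall x, is_derive f x (f' x)) -> periodic f ->
  is_lim_seq (fun N => fourier_sum f N a) (PI * f a).
Proof.
  intros Hd Hper.
  assert (HPI := PI_RGT_0).
  assert (Hf : forall x, continuous f x) by (intros x; cont).
  assert (Hfa : forall t, continuous (fun s => f (a + s)) t).
  { intros t; apply (continuous_comp (fun s => a + s) f); [cont|apply Hf]. }
  set (g := fun t => f (a + t) - f a).
  assert (Hgd : forall t, is_derive g t (f' (a + t))).
  { intros t; unfold g; auto_derive.
    - now exists (f' (a + t)).
    - rewrite Rmult_1_l; now apply is_derive_unique. }
  assert (Hg0 : g 0 = 0) by (unfold g; rewrite Rplus_0_r; ring).
  (* The value 2 f'(a) fills the removable singularity of g(t) cot(t/2): g has slope f'(a) at 0, and
     sin(t/2) has slope 1/2. *)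
  set (h := fun t => if Req_EM_T t 0 then 2 * f' a else g t * cos (t / 2) / sin (t / 2)).
  assert (Hh : forall x, - PI <= x <= - PI + 2 * PI -> continuous h x).
  { intros x Hx; destruct (Req_EM_T x 0) as [->|Hx0].
    - destruct (is_derive_slope g 0 _ (Hgd 0)) as (phi & Hphi & Hphi0 & Hphig).
      assert (Hs : is_derive (fun t => sin (t / 2)) 0 (/ 2)).
      { auto_derive; [trivial|]. unfold Rdiv; rewrite Rmult_0_l, cos_0; field. }
      destruct (is_derive_slope _ 0 _ Hs) as (psi & Hpsi & Hpsi0 & Hpsig).
      (* Near 0 the factor t common to [g] and the sine cancels, leaving a quotient of the two slope
         functions. *)
      apply (continuous_ext (fun t => phi t * cos (t * / 2) * / psi t)).
      + intros t; apply (@eq_trans R _ (h t)); [|reflexivity].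
        unfold h; destruct (Req_EM_T t 0) as [->|Ht].
        * rewrite Hphi0, Hpsi0, Rmult_0_l, cos_0, Rplus_0_r; field.
        * specialize (Hphig t); specialize (Hpsig t).
          rewrite Hg0, !Rminus_0_r in Hphig.
          unfold Rdiv in Hpsig; rewrite Rmult_0_l, sin_0, !Rminus_0_r in Hpsig.
          unfold Rdiv; rewrite Hphig, Hpsig, Rinv_mult.
          generalize (/ psi t); intros u; field; exact Ht.
      + apply continuous_Rmult; [cont|].
        apply (continuous_comp psi Rinv); [exact Hpsi|].
        apply continuous_Rinv; rewrite Hpsi0; lra.
    - apply (continuous_ext_loc h (fun t => g t * cos (t * / 2) * / sin (t * / 2))).
      + assert (Hd0 : 0 < Rabs x) by now apply Rabs_pos_lt.
        exists (mkposreal _ Hd0); intros y Hy; unfold h.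
        destruct (Req_EM_T y 0) as [->|Hy0]; [|reflexivity].
        exfalso; change (Rabs (0 - x) < Rabs x) in Hy.
        rewrite Rminus_0_l, Rabs_Ropp in Hy; lra.
      + apply continuous_Rmult; [cont|].
        apply (continuous_comp (fun t => sin (t * / 2)) Rinv); [cont|].
        apply continuous_Rinv.
        destruct (Rtotal_order x 0) as [Hlt|[Heq|Hgt]]; [|contradiction|].
        * apply Rlt_not_eq; apply sin_lt_0_var; lra.
        * apply Rgt_not_eq; apply sin_gt_0; lra. }
  assert (Hker : forall N, fourier_sum f N a - PI * f a
     = / 2 * (RInt (fun t => h t * sin (INR (S N) * t)) (- PI) (- PI + 2 * PI)
            + RInt (fun t => g t * cos (INR (S N) * t)) (- PI) (- PI + 2 * PI))).
  { intros N.
    assert (Hsum : fourier_sum f N a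
      = RInt (fun t => f (a + t) * (/ 2 + sum_f_R0 (fun k => cos (INR (S k) * t)) N))
             (- PI) (- PI + 2 * PI)).
    { rewrite (RInt_eq _ (fun t => / 2 * (f (a + t) * cos (INR 0 * t))
           + sum_f_R0 (fun k => f (a + t) * cos (INR (S k) * t)) N)).
      2:{ intros t; rewrite (sum_eq (fun k => f (a + t) * cos (INR (S k) * t))
              (fun k => cos (INR (S k) * t) * f (a + t))) by (intros; ring).
          rewrite <- scal_sum; simpl INR; rewrite Rmult_0_l, cos_0; ring. }
      rewrite RInt_Rplus, RInt_Rscal, (RInt_sum_f_R0 (fun k t => f (a + t) * cos (INR (S k) * t)));
        try (apply ex_RInt_everywhere; intros x; cont); try (intros; cont); [|lra].
      rewrite <- harmonic_shift by assumption.
      unfold fourier_sum; f_equal.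
      - unfold harmonic; simpl INR; rewrite Rmult_0_l, cos_0, sin_0; field.
      - apply sum_eq; intros k _; now apply harmonic_shift. }
    (* The kernel has integral PI over a period, so [PI * f a] is itself an integral against it. *)
    assert (Hone : RInt (fun t => f a * (/ 2 + sum_f_R0 (fun k => cos (INR (S k) * t)) N))
             (- PI) (- PI + 2 * PI) = PI * f a :> R).
    { rewrite RInt_Rscal, RInt_Rplus, RInt_const, (RInt_sum_f_R0 (fun k t => cos (INR (S k) * t)));
        try (apply ex_RInt_everywhere; intros x; cont); try (intros; cont); [|lra].
      rewrite (sum_eq _ (fun _ => 0)).
      - rewrite sum_cte; unfold scal; simpl; unfold mult; simpl; field.
      - intros k _.
        rewrite (RInt_eq _ (fun t => 1 * cos (INR (S k) * t) + 0 * sin (INR (S k) * t)))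
          by (intros; ring).
        apply RInt_wave; [now apply not_0_INR|apply periodic_cos|apply periodic_sin]. }
    rewrite Hsum, <- Hone, <- RInt_Rminus;
      try (apply ex_RInt_on; [lra|]; intros x Hx; cont).
    rewrite <- RInt_Rplus, <- RInt_Rscal;
      try (apply ex_RInt_on; [lra|]; intros x Hx; cont).
    apply RInt_ext; rewrite Rmin_left, Rmax_right by lra; intros t Ht.
    match goal with |- @eq _ ?u ?v => change (@eq R u v) end.
    unfold h; destruct (Req_EM_T t 0) as [->|Ht0].
    - rewrite Rmult_0_r, sin_0; unfold g; rewrite Rplus_0_r; ring.
    - assert (Hs : sin (t / 2) <> 0).
      { destruct (Rtotal_order t 0) as [Hlt|[Heq|Hgt]]; [|contradiction|].
        + apply Rlt_not_eq; apply sin_lt_0_var; lra.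
        + apply Rgt_not_eq; apply sin_gt_0; lra. }
      apply Rmult_eq_reg_l with (2 * sin (t / 2)); [|lra].
      transitivity (g t * (2 * sin (t / 2) * (/ 2 + sum_f_R0 (fun k => cos (INR (S k) * t)) N))).
      + unfold g; ring.
      + rewrite dirichlet_kernel, sin_plus; field; exact Hs. }
  assert (Hker' : forall N, fourier_sum f N a = PI * f a
     + / 2 * (RInt (fun t => h t * sin (INR (S N) * t)) (- PI) (- PI + 2 * PI)
            + RInt (fun t => g t * cos (INR (S N) * t)) (- PI) (- PI + 2 * PI)))
    by (intros N; rewrite <- Hker; ring).
  destruct (riemann_lebesgue h (- PI) Hh) as [_ Hlim1].
  assert (Hg : forall x, - PI <= x <= - PI + 2 * PI -> continuous g x) by (intros x _; cont).
  destruct (riemann_lebesgue g (- PI) Hg) as [Hlim2 _].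
  assert (Hlim : is_lim_seq (fun N => PI * f a
     + / 2 * (RInt (fun t => h t * sin (INR (S N) * t)) (- PI) (- PI + 2 * PI)
            + RInt (fun t => g t * cos (INR (S N) * t)) (- PI) (- PI + 2 * PI)))
     (PI * f a + / 2 * (0 + 0))).
  { apply is_lim_seq_plus'; [apply is_lim_seq_const|].
    apply (is_lim_seq_scal_l _ (/ 2) (0 + 0)).
    now apply is_lim_seq_plus'. }
  replace (PI * f a + / 2 * (0 + 0)) with (PI * f a) in Hlim by ring.
  apply (is_lim_seq_ext _ _ _ (fun N => eq_sym (Hker' N)) Hlim).
Qed.

(** * Fourier coefficients of a C^2 function *)

Definition C2_derivatives (p p1 p2 : R -> R) : Prop :=
  (forall x, is_derive p x (p1 x)) /\ (forall x, is_derive p1 x (p2 x)) /\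
  (forall x, continuous p2 x).

Lemma periodic_derive (f f' : R -> R) :
  (forall x, is_derive f x (f' x)) -> periodic f -> periodic f'.
Proof.
  intros Hf Hper t.
  rewrite <- (is_derive_unique f t _ (Hf t)).
  symmetry; apply is_derive_unique.
  apply (is_derive_ext (fun s => f (s + 2 * PI))); [exact Hper|].
  auto_derive; [now exists (f' (t + 2 * PI))|].
  rewrite Rmult_1_l; now apply is_derive_unique.
Qed.

Lemma RInt_by_parts_periodic (f f' g g' : R -> R) :
  (forall x, is_derive f x (f' x)) -> (forall x, continuous f' x) -> periodic f ->
  (forall x, is_derive g x (g' x)) -> (forall x, continuous g' x) -> periodic g ->
  RInt (fun t => f' t * g t) 0 (2 * PI) = - RInt (fun t => f t * g' t) 0 (2 * PI) :> R.
Proof.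
  intros Hf Hf' Hpf Hg Hg' Hpg.
  assert (H : RInt (fun t => f' t * g t + f t * g' t) 0 (2 * PI) = 0 :> R).
  { apply is_RInt_unique.
    replace 0 with (minus (f (2 * PI) * g (2 * PI)) (f 0 * g 0)) at 2.
    - apply (is_RInt_derive (fun t => f t * g t)).
      + intros x _; exact (is_derive_mult f g x _ _ (Hf x) (Hg x) Rmult_comm).
      + intros x _; cont.
    - replace (2 * PI) with (0 + 2 * PI) by ring; rewrite Hpf, Hpg.
      unfold minus, plus, opp; simpl; ring. }
  rewrite RInt_Rplus in H by (apply ex_RInt_everywhere; intros x; cont); lra.
Qed.

Lemma fcos_derive (f f' : R -> R) (n : nat) :
  (forall x, is_derive f x (f' x)) -> (forall x, continuous f' x) -> periodic f ->
  fcos f' n = INR n * fsin f n.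
Proof.
  intros Hf Hf' Hper; unfold fcos, fsin.
  rewrite (RInt_by_parts_periodic f f' (fun t => cos (INR n * t))
             (fun t => - INR n * sin (INR n * t))); trivial.
  - rewrite (RInt_eq _ (fun t => - INR n * (f t * sin (INR n * t)))) by (intros; ring).
    rewrite RInt_Rscal by (apply ex_RInt_everywhere; intros x; cont); ring.
  - intros x; auto_derive; [trivial|ring].
  - intros x; cont.
  - apply periodic_cos.
Qed.

Lemma fsin_derive (f f' : R -> R) (n : nat) :
  (forall x, is_derive f x (f' x)) -> (forall x, continuous f' x) -> periodic f ->
  fsin f' n = - (INR n * fcos f n).
Proof.
  intros Hf Hf' Hper; unfold fcos, fsin.
  rewrite (RInt_by_parts_periodic f f' (fun t => sin (INR n * t))
             (fun t => INR n * cos (INR n * t))); trivial.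
  - rewrite (RInt_eq _ (fun t => INR n * (f t * cos (INR n * t)))) by (intros; ring).
    rewrite RInt_Rscal by (apply ex_RInt_everywhere; intros x; cont); ring.
  - intros x; auto_derive; [trivial|ring].
  - intros x; cont.
  - apply periodic_sin.
Qed.

Lemma fourier_derive2 (p p1 p2 : R -> R) (n : nat) : C2_derivatives p p1 p2 -> periodic p ->
  fcos p2 n = - (INR n ^ 2 * fcos p n) /\ fsin p2 n = - (INR n ^ 2 * fsin p n).
Proof.
  intros (H1 & H2 & H3) Hper.
  assert (Hp1 : forall x, continuous p1 x) by (intros x; cont).
  assert (Hper1 := periodic_derive p p1 H1 Hper).
  split.
  - rewrite (fcos_derive p1 p2), (fsin_derive p p1) by assumption; ring.
  - rewrite (fsin_derive p1 p2), (fcos_derive p p1) by assumption; ring.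
Qed.

(** In the usual normalization this is PI^2 c_n^2, which accounts for the factors PI in the
    estimates that follow. *)
Definition fsq (f : R -> R) (n : nat) : R := fcos f n ^ 2 + fsin f n ^ 2.

Lemma fsq_nonneg f n : 0 <= fsq f n.
Proof. unfold fsq; generalize (pow2_ge_0 (fcos f n)) (pow2_ge_0 (fsin f n)); lra. Qed.

Lemma harmonic_sqr_le f n t : harmonic f n t ^ 2 <= fsq f n.
Proof.
  unfold harmonic, fsq.
  generalize (sin2_cos2 (INR n * t)) (pow2_ge_0 (fcos f n * sin (INR n * t) - fsin f n * cos (INR n * t))).
  unfold Rsqr; intros H H'.
  replace (fcos f n ^ 2 + fsin f n ^ 2) with ((fcos f n ^ 2 + fsin f n ^ 2) * 1) by ring.
  rewrite <- H; nra.
Qed.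

Lemma bessel_derive2 (p p1 p2 : R -> R) (N : nat) : C2_derivatives p p1 p2 -> periodic p ->
  sum_f_R0 (fun k => INR (S k) ^ 4 * fsq p (S k)) N
  <= PI * RInt (fun t => p2 t ^ 2) 0 (2 * PI).
Proof.
  intros Hp Hper.
  assert (H := bessel p2 0 N); rewrite Rplus_0_l in H.
  refine (Rle_trans _ _ _ (Req_le _ _ _) (H _)).
  - apply sum_eq; intros k _.
    destruct (fourier_derive2 p p1 p2 (S k) Hp Hper) as [Hc Hs].
    unfold fcos in Hc at 1; unfold fsin in Hs at 1; rewrite Hc, Hs; unfold fsq; ring.
  - intros x _; apply Hp.
Qed.

(** A single term of the Bessel sum for p'' already bounds the order-n harmonic by C / n^2,
    uniformly in t. Since 1/(n+1)^2 is at most 1/n - 1/(n+1), the tails telescope to C / n. *)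
Lemma fourier_tail (p p1 p2 : R -> R) : C2_derivatives p p1 p2 -> periodic p ->
  exists C, forall N t, Rabs (PI * p t - fourier_sum p N t) <= C / INR (S N).
Proof.
  intros Hp Hper.
  set (C := sqrt (PI * RInt (fun t => p2 t ^ 2) 0 (2 * PI))); exists C.
  assert (HC : 0 <= C) by apply sqrt_pos.
  assert (Hharm : forall k t, Rabs (harmonic p (S k) t) <= C / INR (S k) ^ 2).
  { intros k t.
    assert (Hn : 0 < INR (S k)) by (apply lt_0_INR; lia).
    assert (Hn2 : 0 < INR (S k) ^ 2) by now apply pow_lt.
    apply Rmult_le_reg_r with (INR (S k) ^ 2); [exact Hn2|].
    replace (C / INR (S k) ^ 2 * INR (S k) ^ 2) with C by (field; lra).
    rewrite <- (Rabs_pos_eq (INR (S k) ^ 2)) by lra.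
    rewrite <- Rabs_mult, <- sqrt_Rsqr_abs; apply sqrt_le_1_alt; unfold Rsqr.
    apply Rle_trans with (INR (S k) ^ 4 * fsq p (S k)).
    - replace (harmonic p (S k) t * INR (S k) ^ 2 * (harmonic p (S k) t * INR (S k) ^ 2))
        with (INR (S k) ^ 4 * harmonic p (S k) t ^ 2) by ring.
      apply Rmult_le_compat_l; [|apply harmonic_sqr_le].
      apply pow_le; lra.
    - apply Rle_trans with (2 := bessel_derive2 p p1 p2 k Hp Hper).
      destruct k as [|k]; [simpl; lra|].
      rewrite tech5.
      assert (0 <= sum_f_R0 (fun k => INR (S k) ^ 4 * fsq p (S k)) k); [|lra].
      apply cond_pos_sum; intros j; apply Rmult_le_pos; [apply pow_le, pos_INR|apply fsq_nonneg]. }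
  intros N t.
  assert (Htail : forall m, Rabs (fourier_sum p (m + N) t - fourier_sum p N t)
            <= C * (/ INR (S N) - / INR (S (m + N)))).
  { induction m as [|m IH].
    - simpl Nat.add; rewrite !Rminus_diag, Rabs_R0; lra.
    - unfold fourier_sum in *; simpl Nat.add in *; rewrite tech5.
      set (u := sum_f_R0 (fun k => harmonic p (S k) t) (m + N)) in *.
      set (v := sum_f_R0 (fun k => harmonic p (S k) t) N) in *.
      replace (fcos p 0 / 2 + (u + harmonic p (S (S (m + N))) t) - (fcos p 0 / 2 + v))
        with ((fcos p 0 / 2 + u - (fcos p 0 / 2 + v)) + harmonic p (S (S (m + N))) t) by ring.
      eapply Rle_trans; [apply Rabs_triang|].
      specialize (Hharm (S (m + N)) t).
      assert (Hn : 0 < INR (S (m + N))) by (apply lt_0_INR; lia).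
      rewrite (S_INR (S (m + N))) in *.
      set (n := INR (S (m + N))) in *.
      assert (C / (n + 1) ^ 2 <= C * (/ n - / (n + 1))); [|lra].
      apply Rmult_le_compat_l; [exact HC|].
      replace (/ n - / (n + 1)) with (/ (n * (n + 1))) by (field; lra).
      apply Rinv_le_contravar; nra. }
  assert (Hlim : is_lim_seq (fun m => Rabs (fourier_sum p (m + N) t - fourier_sum p N t))
                   (Rabs (PI * p t - fourier_sum p N t))).
  { apply (is_lim_seq_abs _ (PI * p t - fourier_sum p N t)).
    apply is_lim_seq_minus'; [|apply is_lim_seq_const].
    apply is_lim_seq_incr_n with (u := fun N => fourier_sum p N t).
    apply (fourier_converges p p1); [apply Hp|exact Hper]. }
  refine (is_lim_seq_le _ (fun _ => C / INR (S N)) _ (C / INR (S N)) _ Hlim (is_lim_seq_const _)).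
  intros m; apply Rle_trans with (1 := Htail m).
  assert (0 < / INR (S (m + N))) by (apply Rinv_0_lt_compat, lt_0_INR; lia).
  unfold Rdiv; apply Rmult_le_compat_l; lra.
Qed.

Lemma is_lim_seq_of_bound (u : nat -> R) (l C : R) :
  (forall n, Rabs (l - u n) <= C / INR (S n)) -> is_lim_seq u l.
Proof.
  intros H.
  assert (H0 : is_lim_seq (fun n => C / INR (S n)) 0).
  { replace 0 with (C * 0) by ring.
    apply (is_lim_seq_scal_l _ C 0).
    apply (is_lim_seq_incr_1 (fun n => / INR n)).
    apply (is_lim_seq_inv _ p_infty); [apply is_lim_seq_INR|discriminate]. }
  assert (H1 : is_lim_seq (fun n => l - u n) 0).
  { apply is_lim_seq_abs_0.
    apply (is_lim_seq_le_le (fun _ => 0) _ (fun n => C / INR (S n))); trivial.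
    - intros n; split; [apply Rabs_pos|apply H].
    - apply is_lim_seq_const. }
  apply (is_lim_seq_ext (fun n => l - (l - u n))); [intros n; ring|].
  assert (H2 := is_lim_seq_minus' (fun _ => l) _ l 0 (is_lim_seq_const l) H1).
  now rewrite Rminus_0_r in H2.
Qed.

(** The bilinear form serves both f = p and f = p'': only the series of p must converge uniformly,
    and it is integrated term by term against a merely continuous f. *)
Lemma parseval (p p1 p2 f : R -> R) : C2_derivatives p p1 p2 -> periodic p ->
  (forall x, continuous f x) ->
  is_lim_seq (fun N => fcos p 0 * fcos f 0 / 2
     + sum_f_R0 (fun k => fcos p (S k) * fcos f (S k) + fsin p (S k) * fsin f (S k)) N)
   (PI * RInt (fun t => p t * f t) 0 (2 * PI)).
Proof.
  intros Hp Hper Hf.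
  assert (HPI := PI_RGT_0).
  assert (Hpc : forall x, continuous p x) by (destruct Hp as [Hp _]; intros x; cont).
  destruct (fourier_tail p p1 p2 Hp Hper) as [C HC].
  assert (Hfabs : forall x, continuous (fun t => Rabs (f t)) x).
  { intros x; apply (continuous_comp f Rabs); [apply Hf|apply continuous_Rabs]. }
  apply is_lim_seq_of_bound with (C := C * RInt (fun t => Rabs (f t)) 0 (2 * PI)).
  intros N.
  assert (Hsc : forall x, continuous (fun t => fourier_sum p N t) x).
  { intros x; unfold fourier_sum, harmonic; cont. }
  assert (Hsum : fcos p 0 * fcos f 0 / 2
     + sum_f_R0 (fun k => fcos p (S k) * fcos f (S k) + fsin p (S k) * fsin f (S k)) N
     = RInt (fun t => fourier_sum p N t * f t) 0 (2 * PI)).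
  { rewrite (RInt_eq _ (fun t => fcos p 0 / 2 * (f t * cos (INR 0 * t))
       + sum_f_R0 (fun k => fcos p (S k) * (f t * cos (INR (S k) * t))
                          + fsin p (S k) * (f t * sin (INR (S k) * t))) N)).
    - rewrite RInt_Rplus, RInt_Rscal;
        try (apply ex_RInt_everywhere; intros x; cont).
      rewrite (RInt_sum_f_R0 (fun k t => fcos p (S k) * (f t * cos (INR (S k) * t))
                          + fsin p (S k) * (f t * sin (INR (S k) * t))));
        [|lra|intros; cont].
      f_equal; [unfold fcos; field|].
      apply sum_eq; intros k _.
      rewrite RInt_Rplus, !RInt_Rscal;
        try (apply ex_RInt_everywhere; intros x; cont); reflexivity.
    - intros t; unfold fourier_sum, harmonic.
      simpl (INR 0); rewrite Rmult_0_l, cos_0.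
      rewrite Rmult_plus_distr_r, (Rmult_comm (sum_f_R0 _ _)), scal_sum.
      f_equal; [ring|]; apply sum_eq; intros; ring. }
  rewrite Hsum, <- RInt_Rscal, <- RInt_Rminus;
    try (apply ex_RInt_everywhere; intros x; cont).
  eapply Rle_trans; [apply (abs_RInt_le (fun t => PI * (p t * f t) - fourier_sum p N t * f t))|].
  - lra.
  - apply ex_RInt_everywhere; intros x; cont.
  - apply Rle_trans with (RInt (fun t => C / INR (S N) * Rabs (f t)) 0 (2 * PI)).
    + apply RInt_le; [lra| | |].
      * apply ex_RInt_everywhere; intros x.
        apply (continuous_comp (fun t => PI * (p t * f t) - fourier_sum p N t * f t) Rabs);
          [cont|apply continuous_Rabs].
      * apply ex_RInt_everywhere; intros x; cont.
      * intros x _.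
        replace (PI * (p x * f x) - fourier_sum p N x * f x)
          with ((PI * p x - fourier_sum p N x) * f x) by ring.
        rewrite Rabs_mult; apply Rmult_le_compat_r; [apply Rabs_pos|apply HC].
    + rewrite RInt_Rscal by (apply ex_RInt_everywhere; intros x; cont).
      apply Req_le; unfold Rdiv; ring.
Qed.

(** * The quadratic inequality *)

(** Stated with x^2 <= y z, the inequality takes weights and their inverses directly, without square
    roots. The inductive step is the inequality of arithmetic and geometric means for the two mixed
    products. *)
Lemma sum_cauchy_schwarz (x y z : nat -> R) (N : nat) :
  (forall k, 0 <= y k) -> (forall k, 0 <= z k) -> (forall k, x k ^ 2 <= y k * z k) ->
  sum_f_R0 x N ^ 2 <= sum_f_R0 y N * sum_f_R0 z N.
Proof.
  intros Hy Hz Hx.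
  induction N as [|N IH]; [apply Hx|].
  rewrite !tech5.
  assert (HY := cond_pos_sum y N Hy); assert (HZ := cond_pos_sum z N Hz).
  specialize (Hx (S N)); specialize (Hy (S N)); specialize (Hz (S N)).
  set (X := sum_f_R0 x N) in *; set (Y := sum_f_R0 y N) in *; set (Z := sum_f_R0 z N) in *.
  generalize dependent (x (S N)); generalize dependent (y (S N)); generalize dependent (z (S N)).
  intros z' Hz' y' Hy' x' Hx'.
  assert (Hprod : (2 * (X * x')) ^ 2 <= (Y * z' + Z * y') ^ 2).
  { apply Rle_trans with (4 * ((Y * Z) * (y' * z'))).
    - replace ((2 * (X * x')) ^ 2) with (4 * (X ^ 2 * x' ^ 2)) by ring.
      apply Rmult_le_compat_l; [lra|].
      apply Rmult_le_compat; trivial; apply pow2_ge_0.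
    - generalize (pow2_ge_0 (Y * z' - Z * y')); nra. }
  assert (Hpos : 0 <= Y * z' + Z * y')
    by (apply Rplus_le_le_0_compat; apply Rmult_le_pos; assumption).
  assert (2 * (X * x') <= Y * z' + Z * y').
  { apply Rsqr_incr_0_var; [unfold Rsqr; nra|exact Hpos]. }
  nra.
Qed.

(** Its inverse is the general term of the series in [steiner_const]. *)
Definition steiner_weight (alpha lambda delta n : R) : R :=
  (2 * alpha * (n ^ 2 - 1) - lambda + delta * n ^ 2) * (n ^ 2 - 1).

(** The first factor equals (2 alpha + delta) (n^2 - 4) plus its value at n = 2, and n^2 - 1 >= n (n
    - 1). The product n (n - 1) is chosen because its inverses telescope. *)
Lemma steiner_weight_ge alpha lambda delta n :
  2 * alpha + delta >= 0 -> 6 * alpha - lambda + 4 * delta > 0 -> 2 <= n ->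
  (6 * alpha - lambda + 4 * delta) * (n * (n - 1)) <= steiner_weight alpha lambda delta n.
Proof.
  intros H1 H3 Hn; unfold steiner_weight.
  apply Rmult_le_compat; [lra|nra| |nra].
  assert (0 <= (2 * alpha + delta) * (n ^ 2 - 4)) by (apply Rmult_le_pos; nra).
  nra.
Qed.

Lemma steiner_weight_pos alpha lambda delta n :
  2 * alpha + delta >= 0 -> 6 * alpha - lambda + 4 * delta > 0 -> 2 <= n ->
  0 < steiner_weight alpha lambda delta n.
Proof.
  intros H1 H3 Hn.
  eapply Rlt_le_trans; [|now apply steiner_weight_ge].
  apply Rmult_lt_0_compat; nra.
Qed.

Lemma INR_add2_ge k : 2 <= INR (k + 2).
Proof. rewrite plus_INR; change (INR 2) with 2; generalize (pos_INR k); lra. Qed.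

(** Without convergence [Series] would be the default value 0 and could not bound the partial
    sums. *)
Lemma ex_series_steiner alpha lambda delta :
  2 * alpha + delta >= 0 -> 6 * alpha - lambda + 4 * delta > 0 ->
  ex_series (fun k => / steiner_weight alpha lambda delta (INR (k + 2))).
Proof.
  intros H1 H3.
  set (c := 6 * alpha - lambda + 4 * delta) in *.
  apply (ex_series_bounded _ (/ c)).
  - intros k; apply Rlt_le, Rinv_0_lt_compat, steiner_weight_pos; trivial; apply INR_add2_ge.
  - intros N.
    assert (Hc : 0 < / c) by (apply Rinv_0_lt_compat; lra).
    assert (Hk : forall k, / steiner_weight alpha lambda delta (INR (k + 2))
                 <= / c * (/ (INR k + 1) - / (INR k + 2))).
    { intros k; assert (Hk := pos_INR k).
      replace (/ c * (/ (INR k + 1) - / (INR k + 2)))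
        with (/ (c * ((INR k + 2) * (INR k + 2 - 1)))) by (field; lra).
      rewrite plus_INR; change (INR 2) with 2.
      apply Rinv_le_contravar.
      - apply Rmult_lt_0_compat; nra.
      - apply steiner_weight_ge; trivial; lra. }
    apply Rle_trans with (/ c * (1 - / (INR N + 2))).
    + induction N as [|N IH].
      * eapply Rle_trans; [apply Hk|simpl; rewrite Rplus_0_l, Rinv_1; lra].
      * rewrite tech5; eapply Rle_trans; [apply Rplus_le_compat; [exact IH|apply Hk]|].
        rewrite S_INR; replace (INR N + 1 + 1) with (INR N + 2) by ring; lra.
    + assert (0 < / (INR N + 2)) by (apply Rinv_0_lt_compat; generalize (pos_INR N); lra).
      nra.
Qed.

(* The functional on the right-hand side of the theorem, once the sign of the
   oriented evolute area is known. *)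
Definition steiner_energy (alpha beta lambda delta : R) (p p1 p2 : R -> R) : R :=
  alpha * RInt (fun t => (p t + p2 t) ^ 2) 0 (2 * PI)
  + beta * RInt p 0 (2 * PI) ^ 2
  + lambda * (/ 2 * RInt (fun t => p t ^ 2 - p1 t ^ 2) 0 (2 * PI))
  + delta * (/ 2 * RInt (fun t => p2 t ^ 2 - p1 t ^ 2) 0 (2 * PI)).

Lemma parseval_value (p p1 p2 : R -> R) : C2_derivatives p p1 p2 -> periodic p ->
  is_lim_seq (fun N => fcos p 0 ^ 2 / 2 + sum_f_R0 (fun k => fsq p (S k)) N)
    (PI * RInt (fun t => p t ^ 2) 0 (2 * PI)).
Proof.
  intros Hp Hper.
  assert (Hpc : forall x, continuous p x) by (destruct Hp as [Hp _]; intros x; cont).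
  rewrite (RInt_eq _ (fun t => p t * p t)) by (intros; ring).
  eapply is_lim_seq_ext; [|exact (parseval p p1 p2 p Hp Hper Hpc)].
  intros N; simpl; f_equal; [field|].
  apply sum_eq; intros; unfold fsq; ring.
Qed.

Lemma RInt_mult_derive2 (p p1 p2 : R -> R) : C2_derivatives p p1 p2 -> periodic p ->
  RInt (fun t => p t * p2 t) 0 (2 * PI) = - RInt (fun t => p1 t ^ 2) 0 (2 * PI) :> R.
Proof.
  intros (H1 & H2 & H3) Hper.
  assert (Hp1 : forall x, continuous p1 x) by (intros x; cont).
  rewrite (RInt_eq (fun t => p1 t ^ 2) (fun t => p1 t * p1 t)) by (intros; ring).
  rewrite (RInt_by_parts_periodic p p1 p1 p2); trivial; [symmetry; apply Ropp_involutive|].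
  now apply (periodic_derive p p1).
Qed.

Lemma parseval_derive (p p1 p2 : R -> R) : C2_derivatives p p1 p2 -> periodic p ->
  is_lim_seq (sum_f_R0 (fun k => INR (S k) ^ 2 * fsq p (S k)))
    (PI * RInt (fun t => p1 t ^ 2) 0 (2 * PI)).
Proof.
  intros Hp Hper.
  assert (Hpar := parseval p p1 p2 p2 Hp Hper (proj2 (proj2 Hp))).
  rewrite (RInt_mult_derive2 p p1 p2 Hp Hper) in Hpar.
  apply is_lim_seq_opp in Hpar.
  replace (PI * RInt (fun t => p1 t ^ 2) 0 (2 * PI))
    with (- (PI * - RInt (fun t => p1 t ^ 2) 0 (2 * PI))) by ring.
  eapply is_lim_seq_ext; [|exact Hpar].
  intros N; cbv beta.
  destruct (fourier_derive2 p p1 p2 0 Hp Hper) as [-> _].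
  rewrite (sum_eq (fun k => fcos p (S k) * fcos p2 (S k) + fsin p (S k) * fsin p2 (S k))
             (fun k => INR (S k) ^ 2 * fsq p (S k) * -1)).
  - rewrite <- scal_sum; simpl INR; field.
  - intros k _; destruct (fourier_derive2 p p1 p2 (S k) Hp Hper) as [-> ->]; unfold fsq; ring.
Qed.

(** Compares n^2 with n^4 term by term, by Parseval for p' and Bessel for p''. It decides the sign
    of the oriented area of the evolute, and so removes the absolute value from the functional. *)
Lemma wirtinger_second (p p1 p2 : R -> R) : C2_derivatives p p1 p2 -> periodic p ->
  RInt (fun t => p1 t ^ 2) 0 (2 * PI) <= RInt (fun t => p2 t ^ 2) 0 (2 * PI).
Proof.
  intros Hp Hper.
  apply Rmult_le_reg_l with PI; [apply PI_RGT_0|].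
  refine (is_lim_seq_le _ _ _ (PI * RInt (fun t => p2 t ^ 2) 0 (2 * PI)) _
            (parseval_derive p p1 p2 Hp Hper) (is_lim_seq_const _)).
  intros N; eapply Rle_trans; [|exact (bessel_derive2 p p1 p2 N Hp Hper)].
  apply sum_Rle; intros k _.
  apply Rmult_le_compat_r; [apply fsq_nonneg|].
  apply Rle_pow; [|lia].
  rewrite S_INR; generalize (pos_INR k); lra.
Qed.

Lemma steiner_energy_ge (alpha beta lambda delta : R) (p p1 p2 : R -> R) (m : nat) :
  C2_derivatives p p1 p2 -> periodic p ->
  2 * alpha + delta >= 0 -> 2 * alpha + 4 * PI * beta + lambda >= 0 ->
  6 * alpha - lambda + 4 * delta > 0 ->
  sum_f_R0 (fun k => steiner_weight alpha lambda delta (INR (k + 2)) * fsq p (k + 2)) m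
  <= 2 * PI * steiner_energy alpha beta lambda delta p p1 p2.
Proof.
  intros Hp Hper H1 H2 H3.
  assert (HPI := PI_RGT_0).
  assert (Hder := Hp); destruct Hder as (Hd1 & Hd2 & Hc2).
  assert (Hp0c : forall x, continuous p x) by (intros x; cont).
  assert (Hp1c : forall x, continuous p1 x) by (intros x; cont).
  set (P0 := RInt (fun t => p t ^ 2) 0 (2 * PI)).
  set (P1 := RInt (fun t => p1 t ^ 2) 0 (2 * PI)).
  set (P2 := RInt (fun t => p2 t ^ 2) 0 (2 * PI)).
  set (A0 := fcos p 0).
  assert (HA0 : RInt p 0 (2 * PI) = A0 :> R).
  { apply RInt_eq; intros t; simpl; rewrite Rmult_0_l, cos_0; ring. }
  assert (Hcross := RInt_mult_derive2 p p1 p2 Hp Hper); fold P1 in Hcross.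
  assert (HE : steiner_energy alpha beta lambda delta p p1 p2
     = (alpha + lambda / 2) * P0 - (2 * alpha + lambda / 2 + delta / 2) * P1
       + (alpha + delta / 2) * P2 + beta * A0 ^ 2).
  { unfold steiner_energy.
    rewrite (RInt_eq (fun t => (p t + p2 t) ^ 2) (fun t => p t ^ 2 + 2 * (p t * p2 t) + p2 t ^ 2))
      by (intros; ring).
    rewrite !RInt_Rminus, !RInt_Rplus, RInt_Rscal, Hcross, HA0;
      try (apply ex_RInt_everywhere; intros x; cont).
    fold P0 P1 P2; field. }
  set (D := fun k => fsq p (S k)).
  (* Only the integrals of p^2 and p'^2 are replaced by partial sums; that of p''^2 stays whole,
     since for it only Bessel's lower bound is at hand. *)
  set (v := fun N => (alpha + lambda / 2) * (A0 ^ 2 / 2 + sum_f_R0 D N)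
      - (2 * alpha + lambda / 2 + delta / 2) * sum_f_R0 (fun k => INR (S k) ^ 2 * D k) N
      + ((alpha + delta / 2) * (PI * P2) + PI * beta * A0 ^ 2)).
  assert (Hv : is_lim_seq v (PI * steiner_energy alpha beta lambda delta p p1 p2)).
  { replace (PI * steiner_energy alpha beta lambda delta p p1 p2)
      with ((alpha + lambda / 2) * (PI * P0) - (2 * alpha + lambda / 2 + delta / 2) * (PI * P1)
      + ((alpha + delta / 2) * (PI * P2) + PI * beta * A0 ^ 2)) by (rewrite HE; ring).
    apply is_lim_seq_plus'; [|apply is_lim_seq_const].
    apply is_lim_seq_minus'.
    - apply (is_lim_seq_scal_l _ _ (PI * P0)); now apply (parseval_value p p1 p2).
    - apply (is_lim_seq_scal_l _ _ (PI * P1)); now apply (parseval_derive p p1 p2). }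
  set (T := fun k => steiner_weight alpha lambda delta (INR (k + 2)) * fsq p (k + 2)).
  assert (HT : forall k, 0 <= T k).
  { intros k; apply Rmult_le_pos; [|apply fsq_nonneg].
    apply Rlt_le, steiner_weight_pos; trivial; apply INR_add2_ge. }
  assert (Hle : forall N, sum_f_R0 T N / 2 <= v (S N)).
  { intros N.
    assert (HB := bessel_derive2 p p1 p2 (S N) Hp Hper); fold P2 in HB.
    change (sum_f_R0 (fun k => INR (S k) ^ 4 * D k) (S N) <= PI * P2) in HB.
    apply Rmult_le_compat_l with (r := alpha + delta / 2) in HB; [|lra].
    (* Half the weight expands into these coefficients of 1, n^2 and n^4. They add up to 0 at n = 1,
       so the sums of [D], which start at n = 1, match a sum of [T] that starts at n = 2 and has one
       term fewer. *)
    assert (Hid : sum_f_R0 T N / 2 =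
       (alpha + lambda / 2) * sum_f_R0 D (S N)
       - (2 * alpha + lambda / 2 + delta / 2) * sum_f_R0 (fun k => INR (S k) ^ 2 * D k) (S N)
       + (alpha + delta / 2) * sum_f_R0 (fun k => INR (S k) ^ 4 * D k) (S N)).
    { clear. induction N as [|N IH].
      - unfold T, D, steiner_weight; simpl; field.
      - rewrite !(tech5 _ (S N)), tech5.
        replace ((sum_f_R0 T N + T (S N)) / 2) with (sum_f_R0 T N / 2 + T (S N) / 2) by field.
        rewrite IH; unfold T; replace (S N + 2)%nat with (S (S (S N))) by lia.
        unfold D, steiner_weight; field. }
    (* A quarter of this is what the mean value contributes to [v]. *)
    assert (HA : 0 <= (2 * alpha + 4 * PI * beta + lambda) * A0 ^ 2)
      by (apply Rmult_le_pos; [lra|apply pow2_ge_0]).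
    unfold v; nra. }
  assert (Hmain : sum_f_R0 T m / 2 <= PI * steiner_energy alpha beta lambda delta p p1 p2); [|lra].
  (* The shift by [S m] ensures that every partial sum compared contains the first terms up to [m];
     the others are nonnegative. *)
  refine (is_lim_seq_le (fun _ => sum_f_R0 T m / 2) (fun N => v (N + S m)%nat)
            (sum_f_R0 T m / 2) (PI * steiner_energy alpha beta lambda delta p p1 p2) _
            (is_lim_seq_const _) _).
  - intros N; replace (N + S m)%nat with (S (N + m)) by lia.
    eapply Rle_trans; [|apply Hle].
    apply Rmult_le_compat_r; [lra|].
    clear -HT; induction N as [|N IH]; [apply Rle_refl|].
    simpl Nat.add; rewrite tech5; generalize (HT (S (N + m))); lra.
  - now apply is_lim_seq_incr_n.
Qed.

Lemma steiner_energy_nonneg (alpha beta lambda delta : R) (p p1 p2 : R -> R) :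
  C2_derivatives p p1 p2 -> periodic p ->
  2 * alpha + delta >= 0 -> 2 * alpha + 4 * PI * beta + lambda >= 0 ->
  6 * alpha - lambda + 4 * delta > 0 ->
  0 <= steiner_energy alpha beta lambda delta p p1 p2.
Proof.
  intros Hp Hper H1 H2 H3.
  assert (HPI := PI_RGT_0).
  apply Rmult_le_reg_l with (2 * PI); [lra|]; rewrite Rmult_0_r.
  eapply Rle_trans; [|apply (steiner_energy_ge alpha beta lambda delta p p1 p2 0); assumption].
  apply Rmult_le_pos; [|apply fsq_nonneg].
  apply Rlt_le, steiner_weight_pos; trivial; apply INR_add2_ge.
Qed.

Lemma steiner_pointwise (alpha beta lambda delta : R) (p p1 p2 : R -> R) (t : R) :
  C2_derivatives p p1 p2 -> periodic p ->
  2 * alpha + delta >= 0 -> 2 * alpha + 4 * PI * beta + lambda >= 0 ->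
  6 * alpha - lambda + 4 * delta > 0 ->
  (PI * p t - (fcos p 0 / 2 + harmonic p 1 t)) ^ 2
  <= 2 * PI * steiner_energy alpha beta lambda delta p p1 p2
     * Series (fun k => / steiner_weight alpha lambda delta (INR (k + 2))).
Proof.
  intros Hp Hper H1 H2 H3.
  set (w := fun k => steiner_weight alpha lambda delta (INR (k + 2))).
  assert (Hw : forall k, 0 < w k).
  { intros k; apply steiner_weight_pos; trivial; apply INR_add2_ge. }
  assert (Hiw : forall k, 0 <= / w k) by (intros k; apply Rlt_le, Rinv_0_lt_compat, Hw).
  set (B := 2 * PI * steiner_energy alpha beta lambda delta p p1 p2 * Series (fun k => / w k)).
  assert (Hlim : is_lim_seq (fun N => sum_f_R0 (fun k => harmonic p (k + 2) t) N)
                   (PI * p t - (fcos p 0 / 2 + harmonic p 1 t))).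
  { apply (is_lim_seq_ext (fun N => fourier_sum p (N + 1) t - (fcos p 0 / 2 + harmonic p 1 t))).
    - intros N; rewrite Nat.add_1_r; unfold fourier_sum.
      rewrite decomp_sum by lia; simpl pred.
      rewrite (sum_eq (fun k => harmonic p (k + 2) t) (fun k => harmonic p (S (S k)) t)).
      + ring.
      + intros k _; do 2 f_equal; lia.
    - apply is_lim_seq_minus'; [|apply is_lim_seq_const].
      apply is_lim_seq_incr_n with (u := fun N => fourier_sum p N t).
      apply (fourier_converges p p1); [apply Hp|exact Hper]. }
  assert (Hlim2 := is_lim_seq_mult' _ _ _ _ Hlim Hlim).
  replace ((PI * p t - (fcos p 0 / 2 + harmonic p 1 t)) ^ 2)
    with ((PI * p t - (fcos p 0 / 2 + harmonic p 1 t)) * (PI * p t - (fcos p 0 / 2 + harmonic p 1 t)))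
    by ring.
  refine (is_lim_seq_le _ (fun _ => B) _ B _ Hlim2 (is_lim_seq_const _)).
  intros N.
  apply Rle_trans with (sum_f_R0 (fun k => w k * fsq p (k + 2)) N * sum_f_R0 (fun k => / w k) N).
  - eapply Rle_trans; [|apply (sum_cauchy_schwarz (fun k => harmonic p (k + 2) t))].
    + apply Req_le; ring.
    + intros k; apply Rmult_le_pos; [apply Rlt_le, Hw|apply fsq_nonneg].
    + exact Hiw.
    + intros k; replace (w k * fsq p (k + 2) * / w k) with (fsq p (k + 2))
        by (field; apply Rgt_not_eq, Hw).
      apply harmonic_sqr_le.
  - apply Rmult_le_compat.
    + apply cond_pos_sum; intros k; apply Rmult_le_pos; [apply Rlt_le, Hw|apply fsq_nonneg].
    + apply cond_pos_sum; exact Hiw.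
    + now apply steiner_energy_ge.
    + apply (sum_le_Series (fun k => / w k)); [exact Hiw|now apply ex_series_steiner].
Qed.

(** * Supporting tangents of a convex curve *)

Lemma affine_pos_locally (u v z : R) (P : point) :
  0 < u + v * fst P + z * snd P -> locally P (fun Q : point => 0 < u + v * fst Q + z * snd Q).
Proof.
  intros HP.
  assert (Hc : continuous (fun Q : point => u + v * fst Q + z * snd Q) P).
  { apply (continuous_plus (fun Q : point => u + v * fst Q) (fun Q => z * snd Q)).
    - apply (continuous_plus (fun _ : point => u) (fun Q => v * fst Q)); [apply continuous_const|].
      apply (continuous_mult (fun _ : point => v) (fun Q => fst Q)).
      + apply continuous_const.
      + apply continuous_fst.
    - apply (continuous_mult (fun _ : point => z) (fun Q => snd Q)).
      + apply continuous_const.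
      + apply continuous_snd. }
  apply (Hc (fun y => 0 < y)).
  now apply (open_gt 0).
Qed.

Definition wedge (u v : point) : R := fst u * snd v - snd u * fst v.
Definition vec (P Q : point) : point := (fst Q - fst P, snd Q - snd P).

(** Each wedge is affine in the base point, so positivity persists for Q near P. The three values at
    Q are then its unnormalized barycentric coordinates. *)
Lemma triangle_interior (K : point -> Prop) (A B C P : point) :
  convex_set K -> K A -> K B -> K C ->
  0 < wedge (vec P A) (vec P B) -> 0 < wedge (vec P B) (vec P C) ->
  0 < wedge (vec P C) (vec P A) -> locally P K.
Proof.
  intros HK HA HB HC H1 H2 H3.
  set (w := fun (U V Q : point) => wedge U V + (snd U - snd V) * fst Q + (fst V - fst U) * snd Q).
  assert (Hw : forall U V Q, wedge (vec Q U) (vec Q V) = w U V Q)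
    by (intros U V Q; unfold w, wedge, vec; simpl; ring).
  rewrite Hw in H1, H2, H3.
  apply affine_pos_locally in H1; apply affine_pos_locally in H2; apply affine_pos_locally in H3.
  refine (filter_imp _ _ _ (filter_and _ _ H1 (filter_and _ _ H2 H3))).
  intros Q (HC' & HA' & HB').
  fold (w A B Q) in HC'; fold (w B C Q) in HA'; fold (w C A Q) in HB'.
  set (a := w B C Q) in *; set (b := w C A Q) in *; set (c := w A B Q) in *.
  assert (Hs : 0 <= b / (a + b) <= 1).
  { split; [apply Rlt_le, Rdiv_lt_0_compat; lra|].
    apply Rmult_le_reg_r with (a + b); [lra|]; field_simplify; lra. }
  assert (Hr : 0 <= c / (a + b + c) <= 1).
  { split; [apply Rlt_le, Rdiv_lt_0_compat; lra|].
    apply Rmult_le_reg_r with (a + b + c); [lra|]; field_simplify; lra. }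
  (* Convexity speaks of two points, so A and B are joined first and the result is joined to C. *)
  assert (HQ := HK _ _ _ (HK _ _ _ HA HB Hs) HC Hr); simpl in HQ.
  match type of HQ with K ?Z => replace Q with Z; [exact HQ|] end.
  assert (Hsum : a * fst A + b * fst B + c * fst C = (a + b + c) * fst Q
              /\ a * snd A + b * snd B + c * snd C = (a + b + c) * snd Q)
    by (unfold a, b, c, w, wedge; split; ring).
  destruct Hsum as [Hf Hsn].
  apply injective_projections; simpl.
  - apply Rmult_eq_reg_l with (a + b + c); [|lra]; rewrite <- Hf; field; lra.
  - apply Rmult_eq_reg_l with (a + b + c); [|lra]; rewrite <- Hsn; field; lra.
Qed.

Lemma locally_sign_change (f : R -> R) t0 l : is_derive f t0 l -> f t0 = 0 -> 0 < l ->
  locally t0 (fun s => (t0 < s -> 0 < f s) /\ (s < t0 -> f s < 0)).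
Proof.
  intros Hf H0 Hl.
  destruct (is_derive_slope f t0 l Hf) as (phi & Hphi & Hphi0 & Hslope).
  assert (Hloc : locally t0 (fun s => 0 < phi s)).
  { apply (Hphi (fun y => 0 < y)); apply (open_gt 0); now rewrite Hphi0. }
  revert Hloc; apply filter_imp; intros s Hs.
  specialize (Hslope s); rewrite H0, Rminus_0_r in Hslope; rewrite Hslope.
  split; intros Hlt; nra.
Qed.

Lemma locally_neg_of_second_derive (f f' : R -> R) t0 l :
  (forall t, is_derive f t (f' t)) -> is_derive f' t0 l ->
  f t0 = 0 -> f' t0 = 0 -> l < 0 ->
  locally t0 (fun s => s <> t0 -> f s < 0).
Proof.
  intros Hf Hf' H0 H0' Hl.
  assert (Hopp : is_derive (fun t => - f' t) t0 (- l)) by exact (is_derive_opp f' t0 l Hf').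
  destruct (locally_sign_change _ t0 _ Hopp) as [d Hd]; [lra|lra|].
  exists d; intros s Hs Hne.
  assert (Hmvt : forall a b, a < b -> exists c, f b - f a = f' c * (b - a) /\ a < c < b).
  { intros a b Hab; apply MVT_cor2; [exact Hab|].
    intros c _; apply is_derive_Reals, Hf. }
  change (Rabs (s - t0) < d) in Hs.
  assert (Hball : forall c, Rabs (c - t0) < d -> (t0 < c -> 0 < - f' c) /\ (c < t0 -> - f' c < 0))
    by (intros c Hc; apply Hd, Hc).
  destruct (Rtotal_order s t0) as [Hlt|[Heq|Hgt]]; [|contradiction|].
  - destruct (Hmvt s t0 Hlt) as (c & Hc & Hcs).
    rewrite Rabs_left in Hs by lra.
    destruct (Hball c) as [_ Hneg]; [rewrite Rabs_left; lra|].
    specialize (Hneg (proj2 Hcs)); nra.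
  - destruct (Hmvt t0 s Hgt) as (c & Hc & Hcs).
    rewrite Rabs_right in Hs by lra.
    destruct (Hball c) as [Hpos _]; [rewrite Rabs_right; lra|].
    specialize (Hpos (proj1 Hcs)); nra.
Qed.

(* If some x in K lay strictly on the outer side of the tangent at P, the triangle
   with vertices x and two points of the curve just before and just after P
   would contain P in its interior. *)
Lemma tangent_supports (K : point -> Prop) (X X1 X2 Y Y1 Y2 : R -> R) :
  C2_derivatives X X1 X2 -> C2_derivatives Y Y1 Y2 ->
  (forall t, 0 < X1 t * Y2 t - Y1 t * X2 t) ->
  convex_set K -> (forall t, K (X t, Y t)) -> (forall t, ~ locally (X t, Y t) K) ->
  forall t x, K x -> fst x * Y1 t - snd x * X1 t <= X t * Y1 t - Y t * X1 t.
Proof.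
  intros (HX1 & HX2 & _) (HY1 & HY2 & _) Hcross HK Hin Hbd t0 x Hx.
  apply Rnot_lt_le; intros Hlt; apply (Hbd t0).
  set (P := (X t0, Y t0)); set (a1 := X1 t0); set (b1 := Y1 t0).
  assert (Hcr := Hcross t0).
  assert (Htau : 0 < a1 ^ 2 + b1 ^ 2).
  { unfold a1, b1; destruct (Req_EM_T (X1 t0) 0) as [E|E].
    - rewrite E in *; assert (Y1 t0 <> 0) by (intros E'; rewrite E' in Hcr; lra).
      generalize (pow2_gt_0 (Y1 t0)); nra.
    - generalize (pow2_gt_0 (X1 t0) E) (pow2_ge_0 (Y1 t0)); lra. }
  assert (Hder : forall c d t, is_derive (fun s => c * (X s - X t0) + d * (Y s - Y t0)) t
                                 (c * X1 t + d * Y1 t)).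
  { intros c d t; auto_derive.
    - split; [now exists (X1 t)|split; [now exists (Y1 t)|trivial]].
    - rewrite (is_derive_unique (fun x : R => X x) t _ (HX1 t)),
        (is_derive_unique (fun x : R => Y x) t _ (HY1 t)); ring. }
  assert (Hder' : forall c d t, is_derive (fun s => c * X1 s + d * Y1 s) t
                                 (c * X2 t + d * Y2 t)).
  { intros c d t; auto_derive.
    - split; [now exists (X2 t)|split; [now exists (Y2 t)|trivial]].
    - rewrite (is_derive_unique (fun x : R => X1 x) t _ (HX2 t)),
        (is_derive_unique (fun x : R => Y1 x) t _ (HY2 t)); ring. }
  (* Three functions of the displacement from P are controlled near [t0]: its tangential component,
     its outer normal component, and its wedge with the direction of x, whose slope is positive
     because x lies beyond the tangent. *)
  destruct (locally_sign_change _ t0 _ (Hder a1 b1 t0)) as [d1 Hd1];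
    [ring|fold a1 b1; nra|].
  destruct (locally_neg_of_second_derive _ _ t0 _ (Hder b1 (- a1)) (Hder' b1 (- a1) t0)) as [d2 Hd2];
    [ring|unfold a1, b1; ring|unfold a1, b1; lra|].
  destruct (locally_sign_change _ t0 _ (Hder (- (snd x - Y t0)) (fst x - X t0) t0)) as [d3 Hd3];
    [ring|lra|].
  set (h := Rmin d1 (Rmin d2 d3) / 2).
  assert (Hmin : 0 < Rmin d1 (Rmin d2 d3))
    by (repeat apply Rmin_pos; apply cond_pos).
  assert (Hh : 0 < h /\ h < d1 /\ h < d2 /\ h < d3).
  { generalize (Rmin_l d1 (Rmin d2 d3)) (Rmin_r d1 (Rmin d2 d3)) (Rmin_l d2 d3) (Rmin_r d2 d3).
    unfold h; lra. }
  destruct Hh as (Hh & Hh1 & Hh2 & Hh3).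
  assert (Hp : forall d : posreal, h < d -> ball t0 d (t0 + h)).
  { intros d Hd; change (Rabs (t0 + h - t0) < d).
    replace (t0 + h - t0) with h by ring; rewrite Rabs_pos_eq; lra. }
  assert (Hm : forall d : posreal, h < d -> ball t0 d (t0 - h)).
  { intros d Hd; change (Rabs (t0 - h - t0) < d).
    replace (t0 - h - t0) with (- h) by ring; rewrite Rabs_Ropp, Rabs_pos_eq; lra. }
  assert (Ba := proj1 (Hd1 _ (Hp d1 Hh1)) ltac:(lra)).
  assert (Aa := proj2 (Hd1 _ (Hm d1 Hh1)) ltac:(lra)).
  assert (Bb := Hd2 _ (Hp d2 Hh2) ltac:(lra)).
  assert (Ab := Hd2 _ (Hm d2 Hh2) ltac:(lra)).
  assert (Be := proj1 (Hd3 _ (Hp d3 Hh3)) ltac:(lra)).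
  assert (Ae := proj2 (Hd3 _ (Hm d3 Hh3)) ltac:(lra)).
  apply (triangle_interior K (X (t0 + h), Y (t0 + h)) (X (t0 - h), Y (t0 - h)) x);
    trivial; unfold wedge, vec; simpl.
  - set (u := X (t0 + h) - X t0) in *; set (v := Y (t0 + h) - Y t0) in *.
    set (u' := X (t0 - h) - X t0) in *; set (v' := Y (t0 - h) - Y t0) in *.
    (* In the frame of tangent and normal at P the two displacements have tangential components of
       opposite signs and both normal components negative, which fixes the sign of their wedge. *)
    apply Rmult_lt_reg_l with (a1 ^ 2 + b1 ^ 2); [exact Htau|]; rewrite Rmult_0_r.
    replace ((a1 ^ 2 + b1 ^ 2) * (u * v' - v * u'))
      with ((b1 * u + - a1 * v) * (a1 * u' + b1 * v') - (a1 * u + b1 * v) * (b1 * u' + - a1 * v'))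
      by ring.
    nra.
  - lra.
  - lra.
Qed.

(** * Regularity of the support function *)

Lemma periodic_lower_bound (f : R -> R) (T m : R) : 0 < T ->
  (forall t, f (t + T) = f t) -> (forall t, 0 <= t <= T -> m <= f t) -> forall t, m <= f t.
Proof.
  intros HT Hper Hm t.
  assert (Hnat : forall n t, f (t + INR n * T) = f t).
  { induction n as [|n IH]; intros s.
    - simpl; now rewrite Rmult_0_l, Rplus_0_r.
    - rewrite S_INR; replace (s + (INR n + 1) * T) with (s + INR n * T + T) by ring.
      now rewrite Hper, IH. }
  assert (HZ : forall z t, f (t + IZR z * T) = f t).
  { intros z s; destruct (Z.le_gt_cases 0 z) as [Hz|Hz].
    - rewrite <- (Z2Nat.id z Hz), <- INR_IZR_INZ; apply Hnat.
    - replace z with (- Z.of_nat (Z.to_nat (- z)))%Z by lia.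
      rewrite opp_IZR, <- INR_IZR_INZ.
      rewrite <- (Hnat (Z.to_nat (- z)) (s + _)); f_equal; ring. }
  rewrite <- (HZ (- (up (t / T) - 1))%Z t); apply Hm.
  destruct (archimed (t / T)) as [Hu1 Hu2].
  rewrite opp_IZR, minus_IZR.
  assert (E : t = t / T * T) by (field; lra).
  set (q := t / T) in *; rewrite E; split; nra.
Qed.

Lemma is_derive_nonneg_le (f f' : R -> R) (m a b : R) :
  (forall t, is_derive f t (f' t)) -> (forall t, m <= f' t) -> a <= b ->
  m * (b - a) <= f b - f a.
Proof.
  intros Hf Hm Hab.
  destruct (Req_dec a b) as [->|Hne]; [lra|].
  destruct (MVT_cor2 f f' a b) as (c & -> & _); [lra| |].
  - intros c _; apply is_derive_Reals, Hf.
  - apply Rmult_le_compat_r; [lra|apply Hm].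
Qed.

(** Periodicity gives [k] a positive lower bound m on the whole line. Growth at rate m makes [Th]
    onto and its inverse Lipschitz, and the slope function then yields the derivative. *)
Lemma increasing_inverse (Th k : R -> R) (T : R) : 0 < T ->
  (forall t, is_derive Th t (k t)) -> (forall t, continuous k t) ->
  (forall t, k (t + T) = k t) -> (forall t, 0 < k t) ->
  exists psi, (forall y, Th (psi y) = y) /\ (forall y, is_derive psi y (/ k (psi y))).
Proof.
  intros HT HTh Hk Hper Hpos.
  destruct (continuity_ab_min k 0 T) as (t0 & Hmin & _); [lra| |].
  { intros c _; apply continuity_pt_filterlim, Hk. }
  set (m := k t0) in *.
  assert (Hm : 0 < m) by apply Hpos.
  assert (Hlow : forall t, m <= k t) by (apply (periodic_lower_bound k T); assumption).
  assert (Hinc : forall a b, a <= b -> m * (b - a) <= Th b - Th a)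
    by (intros a b; now apply is_derive_nonneg_le with k).
  (* An informative existence, so that [psi] is read off as a function. The bound [M] is the
     distance from 0 at which growth at rate m has certainly reached y. *)
  assert (Honto : forall y, {t | Th t = y}).
  { intros y.
    set (M := Rabs (y - Th 0) / m).
    assert (HM : 0 <= M) by (apply Rdiv_le_0_compat; [apply Rabs_pos|exact Hm]).
    assert (HmM : m * M = Rabs (y - Th 0)) by (unfold M; field; lra).
    assert (H1 := Hinc 0 M HM); assert (H2 := Hinc (- M) 0 ltac:(lra)).
    assert (H3 := Rle_abs (y - Th 0)); assert (H4 := Rle_abs (- (y - Th 0))).
    rewrite Rabs_Ropp in H4.
    destruct (IVT_cor (fun t => Th t - y) (- M) M) as [t [_ Ht]].
    - intros t; apply continuity_pt_filterlim.
      change (continuous (fun t => Th t - y) t); cont.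
    - lra.
    - apply Rmult_le_0_r; nra.
    - exists t; lra. }
  set (psi := fun y => proj1_sig (Honto y)).
  assert (Hpsi : forall y, Th (psi y) = y) by (intros y; exact (proj2_sig (Honto y))).
  exists psi; split; [exact Hpsi|].
  assert (Hlip : forall y z, m * Rabs (psi z - psi y) <= Rabs (z - y)).
  { intros y z.
    rewrite <- (Hpsi y) at 2; rewrite <- (Hpsi z) at 2.
    destruct (Rle_dec (psi y) (psi z)) as [Hle|Hle].
    - assert (H := Hinc _ _ Hle); rewrite !Rabs_pos_eq; nra.
    - assert (H := Hinc (psi z) (psi y) ltac:(lra)).
      rewrite !Rabs_left1; nra. }
  assert (Hcont : forall y, continuous psi y).
  { intros y; apply continuity_pt_filterlim; intros eps Heps.
    exists (m * eps); split; [apply Rmult_lt_0_compat; assumption|].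
    intros z [_ Hz]; simpl in *; unfold R_dist in *.
    apply Rmult_lt_reg_l with m; [exact Hm|].
    apply Rle_lt_trans with (1 := Hlip y z); exact Hz. }
  intros y.
  destruct (is_derive_slope Th (psi y) _ (HTh (psi y))) as (phi & Hphi & Hphi0 & Hslope).
  rewrite <- Hphi0.
  apply (slope_is_derive psi (fun z => / phi (psi z))).
  - apply (continuous_comp (fun z => phi (psi z)) Rinv).
    + apply (continuous_comp psi phi); [apply Hcont|exact Hphi].
    + apply continuous_Rinv; rewrite Hphi0; apply Rgt_not_eq, Hpos.
  (* The slope cannot vanish at [psi z]: this would force z = y, where it equals the positive
     [k (psi y)]. *)
  - intros z; assert (Hz := Hslope (psi z)); rewrite !Hpsi in Hz.
    rewrite Hz; field; intros E.
    rewrite E, Rmult_0_l in Hz.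
    assert (Hzy : z = y) by lra; rewrite Hzy, Hphi0 in E.
    generalize (Hpos (psi y)); lra.
Qed.

Lemma exists_angle (x y : R) : x ^ 2 + y ^ 2 = 1 -> exists t, cos t = x /\ sin t = y.
Proof.
  intros H.
  assert (Hx : -1 <= x <= 1) by nra.
  assert (Hs : sqrt (1 - x ^ 2) = Rabs y).
  { rewrite <- sqrt_Rsqr_abs; f_equal; unfold Rsqr; lra. }
  assert (Hc := cos_acos x Hx); assert (Hsin := sin_acos x Hx).
  unfold Rsqr in Hsin; replace (1 - x * x) with (1 - x ^ 2) in Hsin by ring; rewrite Hs in Hsin.
  destruct (Rle_dec 0 y) as [Hy|Hy].
  - exists (acos x); split; [exact Hc|]; now rewrite Hsin, Rabs_pos_eq.
  - exists (- acos x); rewrite cos_neg, sin_neg; split; [exact Hc|].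
    rewrite Hsin, Rabs_left; lra.
Qed.

Lemma is_derive_0_constant (f : R -> R) : (forall t, is_derive f t 0) -> forall s t, f s = f t.
Proof.
  intros Hf.
  assert (H : forall a b, a < b -> f a = f b).
  { intros a b Hab; apply (eq_is_derive f a b); [intros t _; apply Hf|exact Hab]. }
  intros s t; destruct (Rtotal_order s t) as [Hlt|[->|Hgt]].
  - now apply H.
  - reflexivity.
  - symmetry; now apply H.
Qed.

(** Integrating the angular speed avoids choosing an argument continuously. The inner product and
    the wedge of (N1, N2) with (cos Th, sin Th) have derivative 0, so they keep their initial values
    1 and 0. *)
Lemma angle_lift (N1 N2 k : R -> R) :
  (forall t, is_derive N1 t (- (k t * N2 t))) -> (forall t, is_derive N2 t (k t * N1 t)) ->
  (forall t, continuous k t) -> N1 0 ^ 2 + N2 0 ^ 2 = 1 ->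
  exists Th, (forall t, is_derive Th t (k t)) /\
    (forall t, cos (Th t) = N1 t /\ sin (Th t) = N2 t).
Proof.
  intros HN1 HN2 Hk H0.
  destruct (exists_angle _ _ H0) as (th0 & Hc0 & Hs0).
  set (Th := fun t => th0 + RInt k 0 t).
  assert (HTh : forall t, is_derive Th t (k t)).
  { intros t; unfold Th.
    replace (k t) with (plus zero (k t)) by apply plus_zero_l.
    apply (is_derive_plus (fun _ => th0) (fun t => RInt k 0 t)).
    - apply @is_derive_const.
    - apply (is_derive_RInt k (fun t => RInt k 0 t) 0 t); [|apply Hk].
      apply filter_forall; intros s.
      apply (@RInt_correct R_CompleteNormedModule), ex_RInt_everywhere, Hk. }
  assert (HTh0 : Th 0 = th0).
  { unfold Th; rewrite RInt_point; apply Rplus_0_r. }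
  clearbody Th; exists Th; split; [exact HTh|].
  assert (Hder : forall t, is_derive (fun s => N1 s * cos (Th s) + N2 s * sin (Th s)) t 0
                        /\ is_derive (fun s => N1 s * sin (Th s) - N2 s * cos (Th s)) t 0).
  { intros t.
    assert (Hc := is_derive_Rcomp cos Th t _ _ (is_derive_cos _) (HTh t)).
    assert (Hs := is_derive_Rcomp sin Th t _ _ (is_derive_sin _) (HTh t)).
    split.
    - refine (is_derive_eq _ _ _ _ (is_derive_Rplus _ _ _ _ _
        (is_derive_Rmult _ _ _ _ _ (HN1 t) Hc) (is_derive_Rmult _ _ _ _ _ (HN2 t) Hs)) _); ring.
    - refine (is_derive_eq _ _ _ _ (is_derive_Rminus _ _ _ _ _
        (is_derive_Rmult _ _ _ _ _ (HN1 t) Hs) (is_derive_Rmult _ _ _ _ _ (HN2 t) Hc)) _); ring. }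
  intros t.
  assert (Hd1 := is_derive_0_constant _ (fun s => proj1 (Hder s)) t 0).
  assert (Hd2 := is_derive_0_constant _ (fun s => proj2 (Hder s)) t 0).
  cbv beta in Hd1, Hd2; rewrite HTh0, Hc0, Hs0 in Hd1, Hd2.
  assert (Hcs := sin2_cos2 (Th t)); unfold Rsqr in Hcs.
  set (c := cos (Th t)) in *; set (s := sin (Th t)) in *.
  assert (Hd1' : N1 t * c + N2 t * s = 1) by (rewrite Hd1, <- H0; ring).
  assert (Hd2' : N1 t * s - N2 t * c = 0) by (rewrite Hd2; ring).
  split.
  - transitivity (c * (N1 t * c + N2 t * s) + s * (N1 t * s - N2 t * c)).
    + rewrite Hd1', Hd2'; ring.
    + transitivity (N1 t * (s * s + c * c)); [ring|rewrite Hcs; ring].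
  - transitivity (s * (N1 t * c + N2 t * s) - c * (N1 t * s - N2 t * c)).
    + rewrite Hd1', Hd2'; ring.
    + transitivity (N2 t * (s * s + c * c)); [ring|rewrite Hcs; ring].
Qed.

Lemma support_attained (K : point -> Prop) (theta : R) (z : point) :
  K z -> (forall x, K x -> dot x (unit_normal theta) <= dot z (unit_normal theta)) ->
  support K theta = dot z (unit_normal theta).
Proof.
  intros Hz Hmax; unfold support.
  rewrite (is_lub_Rbar_unique _ (Finite (dot z (unit_normal theta)))); [reflexivity|].
  split.
  - intros r (x & Hx & ->); exact (Hmax x Hx).
  - intros b Hb; apply Hb; now exists z.
Qed.

(* In the parametrization by the normal angle, p = X cos + Y sin has derivative
   p' = Y cos - X sin, the contribution of the velocity being orthogonal to the
   normal; hence p' is again differentiable although gamma is only C^2. *)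
Lemma support_C2_positive (K : point -> Prop) (X X1 X2 Y Y1 Y2 : R -> R) (T : R) :
  C2_derivatives X X1 X2 -> C2_derivatives Y Y1 Y2 ->
  (forall t, 0 < X1 t * Y2 t - Y1 t * X2 t) ->
  0 < T -> (forall t, X (t + T) = X t) -> (forall t, Y (t + T) = Y t) ->
  convex_set K -> (forall t, K (X t, Y t)) -> (forall t, ~ locally (X t, Y t) K) ->
  exists p1 p2, C2_derivatives (support K) p1 p2 /\
    forall theta, exists t, support K theta = dot (X t, Y t) (unit_normal theta) /\
      forall x, K x -> dot x (unit_normal theta) <= support K theta.
Proof.
  intros HX HY Hcross HT HperX HperY HK Hin Hbd.
  assert (Htan := tangent_supports K X X1 X2 Y Y1 Y2 HX HY Hcross HK Hin Hbd).
  destruct HX as (HX1 & HX2 & HX2c), HY as (HY1 & HY2 & HY2c).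
  assert (Hshift : forall f f' : R -> R, (forall t, is_derive f t (f' t)) ->
            (forall t, f (t + T) = f t) -> forall t, f' (t + T) = f' t).
  { intros f f' Hf Hf' t.
    rewrite <- (is_derive_unique f t _ (Hf t)).
    symmetry; apply is_derive_unique.
    apply (is_derive_ext (fun s => f (s + T))); [exact Hf'|].
    auto_derive; [now exists (f' (t + T))|].
    rewrite Rmult_1_l; now apply is_derive_unique. }
  assert (HperX1 := Hshift X X1 HX1 HperX); assert (HperX2 := Hshift X1 X2 HX2 HperX1).
  assert (HperY1 := Hshift Y Y1 HY1 HperY); assert (HperY2 := Hshift Y1 Y2 HY2 HperY1).
  set (q := fun t => X1 t ^ 2 + Y1 t ^ 2).
  assert (Hq : forall t, 0 < q t).
  { intros t; specialize (Hcross t); unfold q.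
    destruct (Req_EM_T (X1 t) 0) as [E|E].
    - rewrite E in *; assert (Y1 t <> 0) by (intros E'; rewrite E' in Hcross; lra).
      generalize (pow2_gt_0 (Y1 t)); nra.
    - generalize (pow2_gt_0 (X1 t) E) (pow2_ge_0 (Y1 t)); lra. }
  assert (Hqd : forall t, is_derive q t (2 * (X1 t * X2 t + Y1 t * Y2 t))).
  { intros t; apply (is_derive_ext (fun t => X1 t * X1 t + Y1 t * Y1 t)).
    - intros s; unfold q; simpl; now rewrite !Rmult_1_r.
    - refine (is_derive_eq _ _ _ _ (is_derive_Rplus _ _ _ _ _
        (is_derive_Rmult _ _ _ _ _ (HX2 t) (HX2 t))
        (is_derive_Rmult _ _ _ _ _ (HY2 t) (HY2 t))) _); ring. }
  set (v := fun t => sqrt (q t)).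
  assert (Hv : forall t, 0 < v t) by (intros t; apply sqrt_lt_R0, Hq).
  assert (Hvq : forall t, v t * v t = q t) by (intros t; apply sqrt_sqrt, Rlt_le, Hq).
  assert (Hvd : forall t, is_derive v t ((X1 t * X2 t + Y1 t * Y2 t) / v t)).
  { intros t; refine (is_derive_eq _ _ _ _ (is_derive_sqrt q t _ (Hqd t) (Hq t)) _).
    fold (v t); field; apply Rgt_not_eq, Hv. }
  clearbody v.
  (* Speed times curvature: the rate at which the unit normal (Y1, -X1) / v turns. *)
  set (k := fun t => (X1 t * Y2 t - Y1 t * X2 t) / q t).
  assert (Hkpos : forall t, 0 < k t) by (intros t; apply Rdiv_lt_0_compat; trivial).
  assert (Hkc : forall t, continuous k t).
  { intros t; apply (continuous_mult (fun t => X1 t * Y2 t - Y1 t * X2 t) (fun t => / q t)).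
    - cont.
    - apply (continuous_comp q Rinv); [unfold q; cont|].
      apply continuous_Rinv, Rgt_not_eq, Hq. }
  assert (Hkv : forall t, k t = (X1 t * Y2 t - Y1 t * X2 t) / (v t * v t))
    by (intros t; now rewrite Hvq).
  assert (Hvq' : forall t, v t * v t = X1 t ^ 2 + Y1 t ^ 2) by exact Hvq.
  assert (Hvne : forall t, v t <> 0) by (intros t; apply Rgt_not_eq, Hv).
  assert (Hqne : forall t, X1 t ^ 2 + Y1 t ^ 2 <> 0) by (intros t; apply Rgt_not_eq, Hq).
  destruct (angle_lift (fun t => Y1 t / v t) (fun t => - X1 t / v t) k) as (Th & HTh & Hang); trivial.
  - intros t.
    refine (is_derive_eq _ _ _ _ (is_derive_Rdiv _ _ _ _ _ (HY2 t) (Hvd t) (Hvne t)) _).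
    rewrite Hkv.
    replace (Y2 t * v t) with (Y2 t * (v t * v t) / v t) by (field; trivial).
    rewrite (Hvq' t) at 1; field; trivial.
  - intros t.
    refine (is_derive_eq _ _ _ _ (is_derive_Rdiv _ _ _ _ _ (is_derive_opp X1 t _ (HX2 t)) (Hvd t) (Hvne t)) _).
    rewrite Hkv; change (opp (X1 t)) with (- X1 t); change (opp (X2 t)) with (- X2 t).
    replace (- X2 t * v t) with (- X2 t * (v t * v t) / v t) by (field; trivial).
    rewrite (Hvq' t) at 1; field; trivial.
  - replace ((Y1 0 / v 0) ^ 2 + (- X1 0 / v 0) ^ 2) with ((X1 0 ^ 2 + Y1 0 ^ 2) / (v 0 * v 0))
      by (field; trivial).
    rewrite Hvq'; field; trivial.
  - destruct (increasing_inverse Th k T) as (psi & Hpsi & Hpsid); trivial.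
    { intros t; unfold k, q; now rewrite HperX1, HperX2, HperY1, HperY2. }
    assert (Hcos : forall y, cos y = Y1 (psi y) / v (psi y))
      by (intros y; rewrite <- (Hpsi y) at 1; apply Hang).
    assert (Hsin : forall y, sin y = - X1 (psi y) / v (psi y))
      by (intros y; rewrite <- (Hpsi y) at 1; apply Hang).
    assert (Hmax : forall y x, K x ->
      dot x (unit_normal y) <= dot (X (psi y), Y (psi y)) (unit_normal y)).
    { intros y x Hx; unfold dot, unit_normal; simpl; rewrite Hcos, Hsin.
      assert (Ht := Htan (psi y) x Hx).
      apply Rmult_le_reg_r with (v (psi y)); [apply Hv|].
      field_simplify; trivial; lra. }
    assert (Hsup : forall y, support K y = dot (X (psi y), Y (psi y)) (unit_normal y))
      by (intros y; apply support_attained; [apply Hin|apply Hmax]).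
    set (w := fun y => - X1 (psi y) * sin y + Y1 (psi y) * cos y).
    assert (HXpsi : forall y, is_derive (fun y => X (psi y)) y (/ k (psi y) * X1 (psi y)))
      by (intros y; apply (is_derive_Rcomp X psi); [apply HX1|apply Hpsid]).
    assert (HYpsi : forall y, is_derive (fun y => Y (psi y)) y (/ k (psi y) * Y1 (psi y)))
      by (intros y; apply (is_derive_Rcomp Y psi); [apply HY1|apply Hpsid]).
    assert (Horth : forall y, X1 (psi y) * cos y + Y1 (psi y) * sin y = 0)
      by (intros y; rewrite Hcos, Hsin; field; trivial).
    exists (fun y => Y (psi y) * cos y - X (psi y) * sin y).
    (* The bracket is the speed, so the first summand is the radius of curvature and the second is
       p. *)
    exists (fun y => / k (psi y) * (Y1 (psi y) * cos y - X1 (psi y) * sin y)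
                     - (X (psi y) * cos y + Y (psi y) * sin y)).
    split; [split; [|split]|].
    + intros y.
      apply (is_derive_ext (fun y => X (psi y) * cos y + Y (psi y) * sin y));
        [intros z; symmetry; apply Hsup|].
      refine (is_derive_eq _ _ _ _ (is_derive_Rplus _ _ _ _ _
        (is_derive_Rmult _ _ _ _ _ (HXpsi y) (is_derive_cos y))
        (is_derive_Rmult _ _ _ _ _ (HYpsi y) (is_derive_sin y))) _).
      transitivity (/ k (psi y) * (X1 (psi y) * cos y + Y1 (psi y) * sin y)
        + (Y (psi y) * cos y - X (psi y) * sin y)); [ring|rewrite Horth; ring].
    + intros y.
      refine (is_derive_eq _ _ _ _ (is_derive_Rminus _ _ _ _ _
        (is_derive_Rmult _ _ _ _ _ (HYpsi y) (is_derive_cos y))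
        (is_derive_Rmult _ _ _ _ _ (HXpsi y) (is_derive_sin y))) _); ring.
    + intros y.
      assert (Hcomp : forall f : R -> R, (forall t, continuous f t) -> continuous (fun y => f (psi y)) y).
      { intros f Hf; apply (continuous_comp psi f); [|apply Hf].
        exact (is_derive_continuous _ _ _ (Hpsid y)). }
      assert (HcX := Hcomp X ltac:(intros t; cont)); assert (HcY := Hcomp Y ltac:(intros t; cont)).
      assert (HcX1 := Hcomp X1 ltac:(intros t; cont)); assert (HcY1 := Hcomp Y1 ltac:(intros t; cont)).
      assert (Hck : continuous (fun y => / k (psi y)) y).
      { apply (continuous_comp (fun y => k (psi y)) Rinv); [now apply Hcomp|].
        apply continuous_Rinv, Rgt_not_eq, Hkpos. }
      cont.
    + intros y; exists (psi y); split; [apply Hsup|].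
      intros x Hx; rewrite Hsup; now apply Hmax.
Qed.

(** Curvature is unsigned here, so the curve may run clockwise. The numerator of the curvature is
    continuous and never 0, hence of constant sign; if it is negative, t is replaced by -t, which
    flips it and keeps the curve. *)
Lemma support_C2 (K : point -> Prop) (gamma : R -> point) :
  C2_plus_curve gamma -> encloses gamma K ->
  exists p1 p2, C2_derivatives (support K) p1 p2 /\
    forall theta, exists t, support K theta = dot (gamma t) (unit_normal theta) /\
      forall x, K x -> dot x (unit_normal theta) <= support K theta.
Proof.
  intros (((T & HT & Hper & _) & _) & HX & HY & Hspeed & Hcurv) ((HK & Hclosed & _) & Hbd).
  set (X := xcoord gamma) in *; set (Y := ycoord gamma) in *.
  set (X1 := Derive X) in *; set (Y1 := Derive Y) in *.
  set (X2 := Derive X1) in *; set (Y2 := Derive Y1) in *.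
  assert (Hgam : forall t, gamma t = (X t, Y t)) by (intros t; apply surjective_pairing).
  assert (HpX : forall t, X (t + T) = X t) by (intros t; unfold X, xcoord; now rewrite Hper).
  assert (HpY : forall t, Y (t + T) = Y t) by (intros t; unfold Y, ycoord; now rewrite Hper).
  assert (Hb : forall t, boundary K (X t, Y t)).
  { intros t; apply Hbd; now exists t. }
  assert (Hin : forall t, K (X t, Y t)).
  (* The second half of [boundary] is literally the premise of [closed]. *)
  { intros t; apply Hclosed; apply Hb. }
  assert (Hnint : forall t, ~ locally (X t, Y t) K) by (intros t; apply Hb).
  assert (HX' : C2_derivatives X X1 X2).
  { destruct HX as (H1 & H2 & H3); split; [|split; [|exact H3]];
      intros t; apply Derive_correct; trivial. }
  assert (HY' : C2_derivatives Y Y1 Y2).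
  { destruct HY as (H1 & H2 & H3); split; [|split; [|exact H3]];
      intros t; apply Derive_correct; trivial. }
  assert (Hne : forall t, X1 t * Y2 t - Y1 t * X2 t <> 0).
  { intros t E; specialize (Hcurv t); unfold curvature in Hcurv.
    fold X Y in Hcurv; fold X1 Y1 in Hcurv; fold X2 Y2 in Hcurv.
    rewrite E, Rabs_R0 in Hcurv; unfold Rdiv in Hcurv; lra. }
  clearbody X2 Y2; clearbody X1 Y1; clearbody X Y.
  assert (Hcont : continuity (fun t => X1 t * Y2 t - Y1 t * X2 t)).
  { destruct HX' as (H1 & H2 & H3), HY' as (H4 & H5 & H6).
    intros t; apply continuity_pt_filterlim.
    change (continuous (fun t => X1 t * Y2 t - Y1 t * X2 t) t); cont. }
  assert (Hsign : forall a b, a <= b ->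
    0 < (X1 a * Y2 a - Y1 a * X2 a) * (X1 b * Y2 b - Y1 b * X2 b)).
  { intros a b Hab; apply Rnot_le_lt; intros Hle.
    destruct (IVT_cor _ a b Hcont Hab Hle) as (z & _ & Hz); exact (Hne z Hz). }
  assert (Hsame : forall t, 0 < (X1 0 * Y2 0 - Y1 0 * X2 0) * (X1 t * Y2 t - Y1 t * X2 t)).
  { intros t; destruct (Rle_dec 0 t) as [Ht|Ht]; [now apply Hsign|].
    rewrite Rmult_comm; apply Hsign; lra. }
  destruct (Rdichotomy _ _ (Hne 0)) as [Hneg|Hpos].
  - assert (Hrev : forall f f' : R -> R, (forall t, is_derive f t (f' t)) ->
              forall t, is_derive (fun s => f (- s)) t (- f' (- t))).
    { intros f f' Hf t.
      refine (is_derive_eq _ _ _ _ (is_derive_Rcomp f Ropp t _ (-1) (Hf (- t)) _) _); [|ring].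
      auto_derive; [trivial|ring]. }
    assert (HrevC : forall f f1 f2, C2_derivatives f f1 f2 ->
              C2_derivatives (fun s => f (- s)) (fun s => - f1 (- s)) (fun s => f2 (- s))).
    { intros f f1 f2 (H1 & H2 & H3); split; [now apply Hrev|split].
      - intros t.
        refine (is_derive_eq _ _ _ _ (is_derive_opp _ t _ (Hrev f1 f2 H2 t)) _).
        apply Ropp_involutive.
      - intros t; apply (continuous_comp Ropp f2); [|apply H3].
        apply (continuous_Ropp (fun s => s)), continuous_id. }
    destruct (support_C2_positive K _ _ _ _ _ _ T (HrevC _ _ _ HX') (HrevC _ _ _ HY'))
      as (p1 & p2 & Hp & Hatt); trivial.
    + intros t; specialize (Hsame (- t)); nra.
    + intros t; rewrite <- (HpX (- (t + T))); f_equal; ring.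
    + intros t; rewrite <- (HpY (- (t + T))); f_equal; ring.
    + exists p1, p2; split; [exact Hp|].
      intros theta; destruct (Hatt theta) as (t & Ht); exists (- t); now rewrite Hgam.
  - destruct (support_C2_positive K _ _ _ _ _ _ T HX' HY') as (p1 & p2 & Hp & Hatt); trivial.
    + intros t; specialize (Hsame t); nra.
    + exists p1, p2; split; [exact Hp|].
      intros theta; destruct (Hatt theta) as (t & Ht); exists t; now rewrite Hgam.
Qed.

(** * The Steiner disc *)

Lemma support_periodic (K : point -> Prop) : periodic (support K).
Proof.
  intros t; unfold support, unit_normal.
  replace (t + 2 * PI) with (t + 2 * INR 1 * PI) by (simpl; ring).
  now rewrite cos_period, sin_period.
Qed.

Lemma dot_unit_normal_le (x c : point) (theta : R) :
  dot x (unit_normal theta) <= dot c (unit_normal theta) + eucl_dist x c.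
Proof.
  unfold dot, unit_normal, eucl_dist; simpl fst; simpl snd.
  set (a := fst x - fst c); set (b := snd x - snd c).
  assert (H : a * cos theta + b * sin theta <= sqrt (a ^ 2 + b ^ 2)); [|unfold a, b in *; lra].
  apply Rle_trans with (1 := Rle_abs _).
  rewrite <- sqrt_Rsqr_abs; apply sqrt_le_1_alt.
  assert (Hcs := sin2_cos2 theta); unfold Rsqr in *.
  generalize (pow2_ge_0 (a * sin theta - b * cos theta)); intros Hsq.
  replace (a ^ 2 + b ^ 2) with ((a ^ 2 + b ^ 2) * 1) by ring; rewrite <- Hcs; nra.
Qed.

Lemma disc_extreme_point (c : point) (r theta : R) : 0 <= r ->
  exists z, eucl_dist z c = r /\ dot z (unit_normal theta) = dot c (unit_normal theta) + r.
Proof.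
  intros Hr; exists (fst c + r * cos theta, snd c + r * sin theta).
  assert (Hcs := sin2_cos2 theta); unfold Rsqr in Hcs.
  unfold eucl_dist, dot, unit_normal; simpl fst; simpl snd; split.
  - replace (_ + _) with (r ^ 2).
    + now apply sqrt_pow2.
    + transitivity (r ^ 2 * (sin theta * sin theta + cos theta * cos theta));
        [rewrite Hcs|]; ring.
  - transitivity (fst c * cos theta + snd c * sin theta
      + r * (sin theta * sin theta + cos theta * cos theta)); [|rewrite Hcs]; ring.
Qed.

Lemma support_disc (c : point) (r theta : R) : 0 <= r ->
  support (fun x => eucl_dist x c <= r) theta = dot c (unit_normal theta) + r.
Proof.
  intros Hr; destruct (disc_extreme_point c r theta Hr) as (z & Hz & Hdot).
  rewrite <- Hdot; apply support_attained; [lra|].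
  intros x Hx; rewrite Hdot; generalize (dot_unit_normal_le x c theta); lra.
Qed.

(** As [real] sends infinite values to 0, the supremum is first enclosed between 0 and B in the
    extended reals. *)
Lemma hausdorff_dist_bound (K M : point -> Prop) (B : R) :
  (forall theta, Rabs (support K theta - support M theta) <= B) ->
  0 <= hausdorff_dist K M <= B.
Proof.
  intros HB; unfold hausdorff_dist.
  set (E := fun d => exists theta, 0 <= theta <= 2 * PI /\
                           d = Rabs (support K theta - support M theta)).
  destruct (Lub_Rbar_correct E) as [Hub Hleast].
  assert (Hle : Rbar_le (Lub_Rbar E) B).
  { apply Hleast; intros d (theta & _ & ->); apply HB. }
  assert (Hge : Rbar_le 0 (Lub_Rbar E)).
  { apply Rbar_le_trans with (Rabs (support K 0 - support M 0)); [apply Rabs_pos|].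
    apply Hub; exists 0; split; [generalize PI_RGT_0; lra|reflexivity]. }
  destruct (Lub_Rbar E) as [l| |]; simpl in *; [lra|contradiction|contradiction].
Qed.

(** The origin may lie outside K, where the support function takes negative values. The sum over
    opposite directions is a width and hence nonnegative. The result makes the radius of the Steiner
    disc admissible in [support_disc]. *)
Lemma perimeter_nonneg (K : point -> Prop) :
  (forall t, continuous (support K) t) ->
  (forall theta, exists x, support K theta = dot x (unit_normal theta) /\
      forall theta', dot x (unit_normal theta') <= support K theta') ->
  0 <= perimeter K.
Proof.
  intros Hc Hatt; unfold perimeter.
  assert (HPI := PI_RGT_0).
  assert (Hsh : forall a t, continuous (fun s => support K (a + s)) t).
  { intros a t; apply (continuous_comp (fun s => a + s) (support K)); [cont|apply Hc]. }
  assert (H : 0 <= RInt (fun t => support K (0 + t) + support K (PI + t)) (- PI) (- PI + 2 * PI)).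
  { apply RInt_ge_0; [lra| |].
    - apply ex_RInt_everywhere; intros x.
      apply (continuous_Rplus (fun t => support K (0 + t)) (fun t => support K (PI + t)));
        apply Hsh.
    - intros t _; rewrite Rplus_0_l.
      destruct (Hatt t) as (x & -> & Hx).
      specialize (Hx (PI + t)); revert Hx.
      unfold dot, unit_normal; simpl fst; simpl snd.
      rewrite (Rplus_comm PI t), neg_cos, neg_sin; lra. }
  rewrite (RInt_Rplus (fun t => support K (0 + t)) (fun t => support K (PI + t))) in H
    by (apply ex_RInt_everywhere; apply Hsh).
  rewrite !RInt_periodic_shift in H by (trivial; apply support_periodic).
  lra.
Qed.

Lemma support_sub_steiner_disc (K : point -> Prop) (theta : R) : 0 <= perimeter K ->
  PI * (support K theta - support (steiner_disc K) theta)
  = PI * support K theta - (fcos (support K) 0 / 2 + harmonic (support K) 1 theta).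
Proof.
  intros HL.
  assert (HPI := PI_RGT_0).
  unfold steiner_disc; rewrite support_disc by (apply Rdiv_le_0_compat; lra).
  assert (H0 : perimeter K = fcos (support K) 0).
  { apply RInt_eq; intros t; simpl; rewrite Rmult_0_l, cos_0; ring. }
  assert (H1 : RInt (fun t => cos t * support K t) 0 (2 * PI) = fcos (support K) 1).
  { apply RInt_eq; intros t; simpl; rewrite Rmult_1_l; ring. }
  assert (H2 : RInt (fun t => sin t * support K t) 0 (2 * PI) = fsin (support K) 1).
  { apply RInt_eq; intros t; simpl; rewrite Rmult_1_l; ring. }
  unfold steiner_point, dot, unit_normal, harmonic; simpl fst; simpl snd.
  rewrite H0, H1, H2; simpl INR; rewrite Rmult_1_l; field; lra.
Qed.

Lemma functional_eq_steiner_energy (K : point -> Prop) (p1 p2 : R -> R) alpha beta lambda delta :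
  C2_derivatives (support K) p1 p2 ->
  alpha * RInt (fun theta => curvature_radius K theta ^ 2) 0 (2 * PI)
     + beta * perimeter K ^ 2 + lambda * area K + delta * Rabs (evolute_area K)
  = steiner_energy alpha beta lambda delta (support K) p1 p2.
Proof.
  intros Hp.
  assert (Hwirt := wirtinger_second _ _ _ Hp (support_periodic K)).
  destruct Hp as (Hp1 & Hp2 & Hp2c).
  assert (D1 : forall t, Derive (support K) t = p1 t) by (intros t; now apply is_derive_unique).
  assert (D2 : forall t, Derive (Derive (support K)) t = p2 t).
  { intros t; rewrite (Derive_ext _ p1) by exact D1; now apply is_derive_unique. }
  assert (Hp1c : forall t, continuous p1 t) by (intros t; cont).
  assert (Hev : Rabs (evolute_area K) = / 2 * RInt (fun t => p2 t ^ 2 - p1 t ^ 2) 0 (2 * PI)).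
  { unfold evolute_area.
    rewrite (RInt_eq _ (fun t => p1 t ^ 2 - p2 t ^ 2)) by (intros t; now rewrite D1, D2).
    rewrite !RInt_Rminus by (apply ex_RInt_everywhere; intros t; cont).
    rewrite Rabs_left1; lra. }
  rewrite Hev; unfold steiner_energy, area, perimeter.
  rewrite (RInt_eq (fun theta => curvature_radius K theta ^ 2)
             (fun t => (support K t + p2 t) ^ 2))
    by (intros t; unfold curvature_radius; now rewrite D2).
  rewrite (RInt_eq (fun theta => support K theta ^ 2 - Derive (support K) theta ^ 2)
             (fun t => support K t ^ 2 - p1 t ^ 2))
    by (intros t; now rewrite D1).
  reflexivity.
Qed.

(** * The functional on a circle, and the conclusion *)

Lemma RInt_of_antiderivative (F f : R -> R) (a b : R) :
  (forall t, is_derive F t (f t)) -> (forall t, continuous f t) ->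
  RInt f a b = F b - F a :> R.
Proof.
  intros HF Hf; apply is_RInt_unique.
  apply (is_RInt_derive F f); intros t _; trivial.
Qed.

Lemma steiner_energy_circle (alpha beta lambda delta r c1 c2 : R) (p p1 p2 : R -> R) :
  C2_derivatives p p1 p2 -> (forall t, p t = c1 * cos t + c2 * sin t + r) ->
  steiner_energy alpha beta lambda delta p p1 p2
  = PI * r ^ 2 * (2 * alpha + 4 * PI * beta + lambda).
Proof.
  intros (Hp1 & Hp2 & _) Hp.
  assert (E1 : forall t, p1 t = - c1 * sin t + c2 * cos t).
  { intros t; rewrite <- (is_derive_unique p t _ (Hp1 t)).
    rewrite (Derive_ext _ _ _ Hp); apply is_derive_unique; auto_derive; [trivial|ring]. }
  assert (E2 : forall t, p2 t = - c1 * cos t - c2 * sin t).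
  { intros t; rewrite <- (is_derive_unique p1 t _ (Hp2 t)).
    rewrite (Derive_ext _ _ _ E1); apply is_derive_unique; auto_derive; [trivial|ring]. }
  assert (I1 : RInt (fun t => (p t + p2 t) ^ 2) 0 (2 * PI) = 2 * PI * r ^ 2 :> R).
  { rewrite (RInt_eq _ (fun _ => r ^ 2)) by (intros t; rewrite Hp, E2; ring).
    rewrite RInt_const; unfold scal; simpl; unfold mult; simpl; ring. }
  assert (I2 : RInt p 0 (2 * PI) = 2 * PI * r :> R).
  { rewrite (RInt_eq _ _ _ _ Hp).
    rewrite (RInt_of_antiderivative (fun t => c1 * sin t - c2 * cos t + r * t)).
    - rewrite sin_2PI, cos_2PI, sin_0, cos_0; ring.
    - intros t; auto_derive; [trivial|ring].
    - intros t; cont. }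
  assert (I3 : RInt (fun t => p t ^ 2 - p1 t ^ 2) 0 (2 * PI) = 2 * PI * r ^ 2 :> R).
  { rewrite (RInt_eq _ (fun t => (c1 * cos t + c2 * sin t + r) ^ 2 - (- c1 * sin t + c2 * cos t) ^ 2))
      by (intros t; now rewrite Hp, E1).
    (* The integrand is r^2 + 2r (c1 cos t + c2 sin t) + (c1^2 - c2^2) cos 2t + 2 c1 c2 sin 2t; only
       r^2 survives over a period. *)
    rewrite (RInt_of_antiderivative (fun t => r ^ 2 * t + 2 * r * (c1 * sin t - c2 * cos t)
       + (c1 ^ 2 - c2 ^ 2) * (sin t * cos t) + 2 * c1 * c2 * (sin t * sin t))).
    - rewrite sin_2PI, cos_2PI, sin_0, cos_0; ring.
    - intros t; auto_derive; [trivial|ring].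
    - intros t; cont. }
  assert (I4 : RInt (fun t => p2 t ^ 2 - p1 t ^ 2) 0 (2 * PI) = 0 :> R).
  { rewrite (RInt_eq _ (fun t => (- c1 * cos t - c2 * sin t) ^ 2 - (- c1 * sin t + c2 * cos t) ^ 2))
      by (intros t; now rewrite E1, E2).
    rewrite (RInt_of_antiderivative (fun t =>
       (c1 ^ 2 - c2 ^ 2) * (sin t * cos t) + 2 * c1 * c2 * (sin t * sin t))).
    - rewrite sin_2PI, cos_2PI, sin_0, cos_0; ring.
    - intros t; auto_derive; [trivial|ring].
    - intros t; cont. }
  unfold steiner_energy; rewrite I1, I2, I3, I4; field.
Qed.

Theorem theorem4p2 (K : point -> Prop) (gamma : R -> point)
    (alpha beta lambda delta : R)
    (Hgamma : C2_plus_curve gamma) (HK : encloses gamma K)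
    (H1 : 2 * alpha + delta >= 0)
    (H2 : 2 * alpha + 4 * PI * beta + lambda >= 0)
    (H3 : 6 * alpha - lambda + 4 * delta > 0) :
  hausdorff_dist K (steiner_disc K) ^ 2 <=
    steiner_const alpha lambda delta *
    (alpha * RInt (fun theta => curvature_radius K theta ^ 2) 0 (2 * PI)
     + beta * perimeter K ^ 2 + lambda * area K
     + delta * Rabs (evolute_area K))
  /\
  (is_circle gamma -> 2 * alpha + 4 * PI * beta + lambda = 0 ->
   hausdorff_dist K (steiner_disc K) ^ 2 =
     steiner_const alpha lambda delta *
     (alpha * RInt (fun theta => curvature_radius K theta ^ 2) 0 (2 * PI)
      + beta * perimeter K ^ 2 + lambda * area K
      + delta * Rabs (evolute_area K))).
Proof.
  destruct (support_C2 K gamma Hgamma HK) as (p1 & p2 & Hp & Hatt).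
  assert (HPI := PI_RGT_0).
  assert (Hper := support_periodic K).
  assert (Hin : forall t, K (gamma t)).
  { intros t; destruct HK as ((_ & Hclosed & _) & Hbd).
    apply Hclosed; apply Hbd; now exists t. }
  rewrite (functional_eq_steiner_energy K p1 p2 alpha beta lambda delta Hp).
  set (E := steiner_energy alpha beta lambda delta (support K) p1 p2).
  assert (HE : 0 <= E) by now apply steiner_energy_nonneg.
  assert (HL : 0 <= perimeter K).
  { apply perimeter_nonneg.
    - intros t; destruct Hp as [Hp _]; cont.
    - intros theta; destruct (Hatt theta) as (t & Ht & _); exists (gamma t); split; [exact Ht|].
      intros theta'; destruct (Hatt theta') as (_ & _ & Hmax); apply Hmax, Hin. }
  set (S := Series (fun k => / steiner_weight alpha lambda delta (INR (k + 2)))).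
  assert (Hpt : forall theta,
    (support K theta - support (steiner_disc K) theta) ^ 2 <= 2 / PI * S * E).
  { intros theta.
    assert (H := steiner_pointwise alpha beta lambda delta _ _ _ theta Hp Hper H1 H2 H3).
    fold S E in H; rewrite <- support_sub_steiner_disc in H by exact HL.
    apply Rmult_le_reg_l with (PI ^ 2); [now apply pow_lt|].
    replace (PI ^ 2 * (2 / PI * S * E)) with (2 * PI * E * S) by (field; lra).
    rewrite Rpow_mult_distr in H; exact H. }
  assert (HM : 0 <= 2 / PI * S * E)
    by (eapply Rle_trans; [apply pow2_ge_0|exact (Hpt 0)]).
  assert (Hle : hausdorff_dist K (steiner_disc K) ^ 2 <= steiner_const alpha lambda delta * E).
  { destruct (hausdorff_dist_bound K (steiner_disc K) (sqrt (2 / PI * S * E))) as [Hd0 Hd].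
    - intros theta; rewrite <- sqrt_Rsqr_abs; apply sqrt_le_1_alt; unfold Rsqr.
      generalize (Hpt theta); lra.
    - apply Rle_trans with (2 / PI * S * E).
      + rewrite <- (pow2_sqrt (2 / PI * S * E)) by exact HM.
        now apply pow_incr.
      (* Nonnegativity of the functional permits enlarging the constant to the maximum. *)
      + apply Rmult_le_compat_r; [exact HE|apply Rmax_r]. }
  split; [exact Hle|].
  intros (c & r & Hr & Hcirc) Hzero.
  assert (HE0 : E = 0).
  { unfold E; rewrite (steiner_energy_circle _ _ _ _ r (fst c) (snd c)); trivial.
    - rewrite Hzero; ring.
    - intros theta; change (support K theta = dot c (unit_normal theta) + r).
      (* The hypothesis concerns the curve alone. For one inequality the support value is attained
         at a curve point at distance r from c; for the other the extreme point of the disc lies on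
         the curve, hence in K. *)
      apply Rle_antisym.
      + destruct (Hatt theta) as (t & -> & _).
        rewrite <- (proj1 (Hcirc (gamma t)) (ex_intro _ t eq_refl)).
        apply dot_unit_normal_le.
      + destruct (disc_extreme_point c r theta) as (z & Hz & <-); [lra|].
        destruct (Hatt theta) as (_ & _ & Hmax); apply Hmax.
        destruct (proj2 (Hcirc z) Hz) as [s <-]; apply Hin. }
  (* The right-hand side is 0, so the inequality already proved squeezes the square of the distance
     to 0. *)
  rewrite HE0, Rmult_0_r in *.
  apply Rle_antisym; [exact Hle|apply pow2_ge_0].
Qed.
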